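(* Let $n\ge1$, $m\ge 1$ and let $b=b(t)$ be a periodic, smooth, positive function on $\mathbb{R}$. Let $(M,h)$ be an $m$-dimensional Riemannian manifold with a global chart in which $M$ possesses intrinsic self coherence structure with direction $(a_1,\ldots,a_m)$ and associated function $f:\mathbb{R}\to\mathbb{R}$, and let $\Gamma^i_{j,k}$ be the Christoffel symbols of $(M,h)$ in this chart. Assume that the Cauchy problem for the wave map system $$u^i_{tt}-n\frac{\dot b(t)}{b(t)}u^i_t-b^2(t)\Delta u^i+\sum_{j,k=1}^m\Gamma^i_{j,k}(u^1,\ldots,u^m)\left(u^j_tu^k_t-b^2(t)\nabla u^j\cdot\nabla u^k\right)=0,\quad i=1,\ldots,m,$$ with initial conditions $u^i(0,x)=u^i_0(x)$, $u^i_t(0,x)=u^i_1(x)$, $i=1,\ldots,m$, $x\in\mathbb{R}^n$, has a global solution $(u^1,\ldots,u^m)\in C^2(\mathbb{R}_+\times\mathbb{R}^n)$ for all initial data $(u^1_\ell,\ldots,u^m_\ell)\in C^\infty(\mathbb{R}^n)\times\cdots\times C^\infty(\mathbb{R}^n)$, $\ell=0,1$. Then the Nakanishi–Ohta condition is fulfilled for $f$: $$\int_0^\infty \exp\left(\int_0^s f(r)\,dr\right)ds=\infty\quad\text{and}\quad \int_{-\infty}^0 \exp\left(\int_0^s f(r)\,dr\right)ds=\infty .$$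
   Context: Notation. $\Delta$ and $\nabla$ are the Laplacian and gradient in $x\in\mathbb{R}^n$; $\dot b=db/dt$; $\mathbb{R}_+=[0,\infty)$. Global chart. $M$ is described by one global chart whose image is an open set $\Omega\subseteq\mathbb{R}^m$; the metric components $h_{ij}$ and the Christoffel symbols $$\Gamma^i_{j,k}(u)=\frac12\sum_{l=1}^m h^{il}\left(\frac{\partial h_{kl}}{\partial u^j}+\frac{\partial h_{jl}}{\partial u^k}-\frac{\partial h_{kj}}{\partial u^l}\right)$$ are smooth functions on $\Omega$, where $(h^{il})$ is the inverse matrix of $(h_{il})$. Maps into $M$ are written as $u=(u^1,\ldots,u^m)$ with values in $\Omega$ (initial data $(u_0^1,\ldots,u_0^m)$ have values in $\Omega$ too). The displayed system is the wave map equation from $\mathbb{R}\times\mathbb{R}^n$ with metric $dt^2-b(t)^{-2}\,|dx|^2$ to $(M,h)$. The initial data are not assumed small. Intrinsic self coherence structure (distinguished geodesic). $M$ possesses intrinsic self coherence structure if in the chart a straight half-line $\{(a_1t,\ldots,a_mt): t\in(0,\infty)\}$, with $(a_1,\ldots,a_m)\ne 0$, is covered by geodesics. In terms of Christoffel symbols this is expressed by a function $f$ such that $$\sum_{j,k=1}^m\Gamma^i_{j,k}(a_1t,\ldots,a_mt)\,a_ja_k=a_i f(t),\qquad i=1,\ldots,m.$$ The associated function $f$ is understood to be a function on all of $\mathbb{R}$: the line $\{(a_1t,\ldots,a_mt):t\in\mathbb{R}\}$ lies in $\Omega$ and the displayed relation holds for all $t\in\mathbb{R}$. *)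

(* Defs.v *)
From HB Require Import structures.
From mathcomp Require Import all_boot all_order all_algebra.
From mathcomp Require Import all_classical all_reals all_analysis.

Set Implicit Arguments.
Unset Strict Implicit.
Unset Printing Implicit Defensive.

Import Order.TTheory GRing.Theory Num.Theory.
Import numFieldNormedType.Exports.

Local Open Scope classical_set_scope.
Local Open Scope ring_scope.

Definition partial (R : realType) (n : nat) (j : 'I_n) (g : 'rV[R]_n -> R)
    (x : 'rV[R]_n) : R :=
  'D_(delta_mx 0 j) g x.

(* Meaningful for [D] open: derivatives are taken in the ambient space. *)
Fixpoint Ck (R : realType) (n : nat) (D : set 'rV[R]_n) (k : nat)
    (g : 'rV[R]_n -> R) : Prop :=
  {in D, continuous g} /\
  if k is k'.+1 then
    forall j : 'I_n, {in D, forall x, derivable g x (delta_mx 0 j)} /\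
                     Ck D k' (partial j g)
  else True.

Definition smooth_on (R : realType) (n : nat) (D : set 'rV[R]_n)
    (g : 'rV[R]_n -> R) : Prop :=
  forall k, Ck D k g.

Definition smooth1 (R : realType) (b : R -> R) : Prop :=
  forall k t, derivable (b^`(k))%classic t 1.

(* A function on R_+ x R^n is represented by [w : R -> 'rV_n -> R], its values
   at negative times being irrelevant.  Accordingly the time derivative is the
   limit of difference quotients over times in R_+ only: the usual derivative
   at t > 0, the right derivative at t = 0. *)
Definition dt_quotient (R : realType) (n : nat) (w : R -> 'rV[R]_n -> R)
    (t : R) (x : 'rV[R]_n) (s : R) : R :=
  s^-1 * (w (t + s) x - w t x).

Definition dt_dom (R : realType) (t : R) : set_system R :=
  within [set s | 0 <= t + s] 0^'.

Definition dt (R : realType) (n : nat) (w : R -> 'rV[R]_n -> R)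
    (t : R) (x : 'rV[R]_n) : R :=
  lim (dt_quotient w t x @ dt_dom t).

Definition dt_exists (R : realType) (n : nat) (w : R -> 'rV[R]_n -> R)
    (t : R) (x : 'rV[R]_n) : Prop :=
  cvg (dt_quotient w t x @ dt_dom t).

Definition dx (R : realType) (n : nat) (j : 'I_n) (w : R -> 'rV[R]_n -> R)
    (t : R) : 'rV[R]_n -> R :=
  partial j (w t).

(* C^k on R_+ x R^n, up to and including the boundary t = 0. *)
Fixpoint Ck_spacetime (R : realType) (n : nat) (k : nat)
    (w : R -> 'rV[R]_n -> R) : Prop :=
  {within [set p : R * 'rV[R]_n | 0 <= p.1],
     continuous (fun p : R * 'rV[R]_n => w p.1 p.2)} /\
  if k is k'.+1 then
    ((forall t x, 0 <= t -> dt_exists w t x) /\ Ck_spacetime k' (dt w)) /\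
    (forall j : 'I_n,
       (forall t x, 0 <= t -> derivable (w t) x (delta_mx 0 j)) /\
       Ck_spacetime k' (dx j w))
  else True.

Definition laplacian (R : realType) (n : nat) (w : R -> 'rV[R]_n -> R)
    (t : R) (x : 'rV[R]_n) : R :=
  \sum_(l < n) dx l (dx l w) t x.

Definition grad_dot (R : realType) (n : nat) (v w : R -> 'rV[R]_n -> R)
    (t : R) (x : 'rV[R]_n) : R :=
  \sum_(l < n) dx l v t x * dx l w t x.

Record riemannian_chart (R : realType) (m : nat) (Omega : set 'rV[R]_m)
    (h : 'rV[R]_m -> 'M[R]_m) : Prop := {
  chart_open : open Omega ;
  metric_smooth : forall i j, smooth_on Omega (fun u => h u i j) ;
  metric_sym : forall u, Omega u -> (h u)^T = h u ;
  metric_pos : forall u, Omega u -> forall v : 'rV[R]_m, v != 0 ->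
    0 < (v *m h u *m v^T) 0 0
}.

(* [christoffel h i j k] is Gamma^i_{j,k}. *)
Definition christoffel (R : realType) (m : nat) (h : 'rV[R]_m -> 'M[R]_m)
    (i j k : 'I_m) (u : 'rV[R]_m) : R :=
  2^-1 * \sum_(l < m) invmx (h u) i l *
    (partial j (fun v => h v k l) u + partial k (fun v => h v j l) u
     - partial l (fun v => h v k j) u).

Definition self_coherent (R : realType) (m : nat) (Omega : set 'rV[R]_m)
    (h : 'rV[R]_m -> 'M[R]_m) (a : 'rV[R]_m) (f : R -> R) : Prop :=
  [/\ a != 0,
      forall t : R, Omega (t *: a) &
      forall (t : R) (i : 'I_m),
        \sum_(j < m) \sum_(k < m) christoffel h i j k (t *: a) * a 0 j * a 0 k
        = a 0 i * f t].

Definition component (R : realType) (n m : nat)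
    (u : R -> 'rV[R]_n -> 'rV[R]_m) (i : 'I_m) : R -> 'rV[R]_n -> R :=
  fun t x => u t x 0 i.

Definition wave_map_eq (R : realType) (n m : nat) (b : R -> R)
    (h : 'rV[R]_m -> 'M[R]_m) (u : R -> 'rV[R]_n -> 'rV[R]_m)
    (i : 'I_m) (t : R) (x : 'rV[R]_n) : Prop :=
  let c := component u in
  dt (dt (c i)) t x - n%:R * ((b^`())%classic t / b t) * dt (c i) t x
  - b t ^+ 2 * laplacian (c i) t x
  + \sum_(j < m) \sum_(k < m) christoffel h i j k (u t x) *
      (dt (c j) t x * dt (c k) t x - b t ^+ 2 * grad_dot (c j) (c k) t x)
  = 0.

Record global_solution (R : realType) (n m : nat) (b : R -> R)
    (Omega : set 'rV[R]_m) (h : 'rV[R]_m -> 'M[R]_m)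
    (u0 u1 : 'rV[R]_n -> 'rV[R]_m) (u : R -> 'rV[R]_n -> 'rV[R]_m) : Prop := {
  sol_C2 : forall i, Ck_spacetime 2 (component u i) ;
  sol_chart : forall t x, 0 <= t -> Omega (u t x) ;
  sol_eq : forall i t x, 0 <= t -> wave_map_eq b h u i t x ;
  sol_init0 : forall x, u 0 x = u0 x ;
  sol_init1 : forall i x, dt (component u i) 0 x = u1 x 0 i
}.

Definition globally_solvable (R : realType) (n m : nat) (b : R -> R)
    (Omega : set 'rV[R]_m) (h : 'rV[R]_m -> 'M[R]_m) : Prop :=
  forall u0 u1 : 'rV[R]_n -> 'rV[R]_m,
    (forall i, smooth_on setT (fun x => u0 x 0 i)) ->
    (forall i, smooth_on setT (fun x => u1 x 0 i)) ->
    (forall x, Omega (u0 x)) ->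
    exists u, global_solution b Omega h u0 u1 u.

(* Oriented: int_0^s f = - int_s^0 f for s < 0. *)
Definition int0 (R : realType) (f : R -> R) (s : R) : R :=
  if 0 <= s then \int[lebesgue_measure]_(r in `[0, s]) f r
  else - \int[lebesgue_measure]_(r in `[s, 0]) f r.

(* Main.v *)
Require Import Defs.
From HB Require Import structures.
From mathcomp Require Import all_boot all_order all_algebra.
From mathcomp Require Import all_classical all_reals all_analysis.
From mathcomp Require Import measurable_realfun ring lra.

Set Implicit Arguments.
Unset Strict Implicit.
Unset Printing Implicit Defensive.

Import Order.TTheory GRing.Theory Num.Theory.
Import numFieldNormedType.Exports.

Local Open Scope classical_set_scope.
Local Open Scope ring_scope.

(** Along the distinguished line the wave map system reduces to an ordinary
    differential equation that can be integrated.  A spatially constant map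
    u = phi(t) a solves the system iff
      phi'' - n (b'/b) phi' + f(phi) phi'^2 = 0,
    and with F(s) = int_0^s f and G(s) = int_0^s e^F this says that G(phi)'
    is a constant multiple of b^n, i.e.
      G(phi(t)) = c int_0^t b^n.
    If int_0^oo e^F were finite, G would map [0, oo) onto a bounded interval
    [0, A), and choosing c with c int_0^1 b^n = A makes phi run off to infinity
    as t -> 1 ([blowup_profile]).  The data (0, phi'(0) a) are smooth and take
    values in the chart, so there is a global solution u with these data; if it
    agrees with phi(t) a for t < 1, it cannot be continuous at t = 1.  The
    condition at -oo is the condition at +oo for the direction - a, whose
    associated function is t |-> - f(- t).

    The work lies in showing that u does agree with phi(t) a, although u is
    only known to be one C^2 solution, with no control at spatial infinity
    ([homogeneous_solution_unique]).  The components w_i of u - phi(t) a have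
    zero data and satisfy
      |d_t^2 w_i - b^2 Laplacian w_i| <= C (|w| + |d_t w| + |grad w|)
    on compact sets, because Christoffel symbols are locally Lipschitz
    ([christoffel_locally_lipschitz]).  Uniqueness for this differential
    inequality is the classical local energy estimate
    ([energy_uniqueness]): the density
      e = sum_i (w_i^2 + (d_t w_i)^2 + b^2 |grad w_i|^2)
    is weighted by the cutoff chi = max(0, r^2 - K t - |x|^2)^2, whose support
    shrinks fast enough (K of the order of r) for the decrease of chi to absorb
    the flux of energy, so that
      d_t (chi e) <= div (flux) + C chi e.

    No n-dimensional integral is needed to exploit this.  The energy is
    replaced by the sum of chi e over a finite grid of the cube [- r, r]^n with
    opposite faces identified.  The sum of difference quotients of the flux
    over such a grid telescopes to zero, since the flux vanishes on the faces;
    hence the sum of its divergence is at most n eps per grid point once the mesh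
    is fine ([grid_divergence]).  Gronwall's inequality then bounds the mean
    over the grid of chi e at time T by a constant times eps, whereas a nonzero
    value of w(T, 0) would keep that mean away from zero as the mesh tends to
    zero ([grid_mass]). *)

(** * Differentiation along lines *)

(** Directional derivatives in R^n are handled as derivatives in one real
    variable, where the mean value theorem is available. *)
Lemma is_derive_lineP (R : realType) (V : normedModType R) (g : V -> R)
    (x v : V) (s d : R) :
  is_derive (x + s *: v) v g d <->
  is_derive s 1 (fun r => g (x + r *: v)) d.
Proof.
have E : (fun h : R => h^-1 *: (g (h *: v + (x + s *: v)) - g (x + s *: v))) =
         (fun h : R => h^-1 *: (g (x + (h *: 1 + s) *: v) - g (x + s *: v))).
  apply/funext => h; congr (_ *: (g _ - _)).
  by rewrite /= [_ *: 1]mulr1 scalerDl addrCA.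
have ED : derivable g (x + s *: v) v = derivable (fun r : R => g (x + r *: v)) s 1.
  by rewrite /derivable E.
have EV : 'D_v g (x + s *: v) = 'D_1 (fun r : R => g (x + r *: v)) s.
  by rewrite /derive E.
split=> -[c l]; apply: DeriveDef; [by rewrite -ED|by rewrite -EV|by rewrite ED|by rewrite EV].
Qed.

Lemma is_derive_line0 (R : realType) (V : normedModType R) (g : V -> R)
    (x v : V) (d : R) :
  is_derive x v g d <-> is_derive (0 : R) 1 (fun r : R => g (x + r *: v)) d.
Proof.
have := is_derive_lineP g x v 0 d; by rewrite scale0r addr0.
Qed.

Lemma is_derive_continuous (R : realType) (g : R -> R) (s d : R) :
  is_derive s 1 g d -> {for s, continuous g}.
Proof.
by case=> c _; apply: differentiable_continuous; apply/derivable1_diffP.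
Qed.

Lemma MVT_everywhere (R : realType) (f df : R -> R) (a b : R) :
  a <= b -> (forall x, a <= x <= b -> is_derive x 1 f (df x)) ->
  exists2 c, a <= c <= b & f b - f a = df c * (b - a).
Proof.
move=> ab Df.
have [|x|c cab E] := @MVT_segment R f df a b ab.
- by move=> x; rewrite in_itv/= => /andP[/ltW ? /ltW ?]; apply: Df; apply/andP.
- apply: continuous_in_subspaceT => y; rewrite inE/= in_itv/= => yab.
  exact: is_derive_continuous (Df _ yab).
- by exists c.
Qed.

Lemma is_derive_pos_sqr (R : realType) (y : R) :
  is_derive y 1 (fun y : R => Num.max 0 y ^+ 2) (2 * Num.max 0 y).
Proof.
have [y0|y0|->] := ltgtP y 0.
- rewrite mulr0.
  apply: (@near_eq_is_derive _ _ _ (cst 0)).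
  near=> z; rewrite max_l ?expr0n//= ltW//; near: z; exact: lt_nbhsl.
- apply: (@near_eq_is_derive _ _ _ (fun z : R => z ^+ 2)); last first.
    by apply: is_derive_eq; rewrite /GRing.scale /= mulr1 mulr_natl.
  near=> z; rewrite max_r// ltW//; near: z; exact: lt_nbhsr.
- rewrite mulr0.
  have H : (fun h : R => h^-1 *: (Num.max 0 (h *: 1 + 0 : R) ^+ 2 - Num.max 0 (0 : R) ^+ 2))
      @ 0^' --> (0:R).
    apply/cvgrPdist_le => /= e e0; near=> h.
    rewrite sub0r normrN [h *: 1]mulr1 addr0 maxxx expr0n subr0 /GRing.scale/=.
    have h0 : h != 0 by near: h; exact: nbhs_dnbhs_neq.
    have he : `|h| <= e by near: h; exact: dnbhs0_le.
    apply: le_trans he; rewrite normrM normfV ler_pdivrMl ?normr_gt0// -expr2.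
    rewrite normrX lerXn2r ?nnegrE// ger0_norm ?le_max ?lexx// ge_max normr_ge0.
    exact: ler_norm.
  by apply: DeriveDef; [apply/cvg_ex; exists 0|exact: cvg_lim].
Unshelve. all: by end_near. Qed.

Section pointwise_rules.
Context {R : realType} {V : normedModType R}.
Implicit Types (f g : V -> R) (x v : V).

Lemma is_derive_mul f g x v (df dg : R) :
  is_derive x v f df -> is_derive x v g dg ->
  is_derive x v (fun y => f y * g y) (df * g x + f x * dg).
Proof.
move=> Df Dg; apply: (is_derive_eq (is_deriveM Df Dg)).
by rewrite addrC /GRing.scale/= [g x * df]mulrC.
Qed.

Lemma is_derive_add f g x v (df dg : R) :
  is_derive x v f df -> is_derive x v g dg ->
  is_derive x v (fun y => f y + g y) (df + dg).
Proof. by move=> Df Dg; exact: is_deriveD. Qed.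

Lemma is_derive_sqr f x v (df : R) :
  is_derive x v f df -> is_derive x v (fun y => f y ^+ 2) (2 * f x * df).
Proof.
move=> Df; apply: (is_derive_eq (is_derive_mul Df Df)); ring.
Qed.

Lemma is_derive_bigsum (I : Type) (s : seq I) (h : I -> V -> R) (dh : I -> R) x v :
  (forall i, is_derive x v (h i) (dh i)) ->
  is_derive x v (fun y => \sum_(i <- s) h i y) (\sum_(i <- s) dh i).
Proof.
move=> D; elim: s => [|i s IH].
  under eq_fun do rewrite big_nil; rewrite big_nil; exact: is_derive_cst.
under eq_fun do rewrite big_cons; rewrite big_cons; exact: is_derive_add.
Qed.

End pointwise_rules.

Lemma is_derive_comp1 (R : realType) (V : normedModType R) (phi : R -> R)
    (g : V -> R) (x v : V) (dphi d : R) :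
  is_derive (g x) 1 phi dphi -> is_derive x v g d ->
  is_derive x v (fun y => phi (g y)) (dphi * d).
Proof.
move=> Dphi /is_derive_line0 Dg; apply/is_derive_line0.
apply: (@is_derive1_comp _ phi (fun s => g (x + s *: v))) => //.
by rewrite scale0r addr0.
Qed.

Lemma is_derive_coord (R : realType) (n : nat) (x v : 'rV[R]_n) (j : 'I_n) :
  is_derive x v (fun y => y 0 j) (v 0 j).
Proof.
apply/is_derive_line0.
have -> : (fun s : R => (x + s *: v) 0 j) = (fun s : R => x 0 j + s * v 0 j).
  by apply/funext => s; rewrite !mxE.
have := is_derive_add (is_derive_cst (x 0 j) (0 : R) 1)
   (is_derive_mul (is_derive_id (0 : R) 1) (is_derive_cst (v 0 j) (0 : R) 1)).
by rewrite mulr0 addr0 mul1r add0r.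
Qed.

(** The mean value theorem in [t] applied to the difference in [s], then the
    mean value theorem in [s]. *)
Lemma second_difference_mixed (R : realType) (g gt gts : R -> R -> R)
    (t s k : R) :
  0 <= k ->
  (forall t' s', t <= t' <= t + k -> s <= s' <= s + k ->
     is_derive t' 1 (fun r => g r s') (gt t' s') /\
     is_derive s' 1 (gt t') (gts t' s')) ->
  exists t' s', [/\ t <= t' <= t + k, s <= s' <= s + k &
    g (t + k) (s + k) - g (t + k) s - (g t (s + k) - g t s) =
      gts t' s' * k * k].
Proof.
move=> k0 D.
have tk : t <= t + k by rewrite lerDl.
have sk : s <= s + k by rewrite lerDl.
have [|t' t'i Et] := @MVT_everywhere R (fun r => g r (s + k) - g r s)
  (fun r => gt r (s + k) - gt r s) _ _ tk.
  move=> r ri; apply: is_deriveB.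
    by apply: (D r (s + k) ri _).1; rewrite sk lexx.
  by apply: (D r s ri _).1; rewrite sk lexx.
have [s' s'i Es] := @MVT_everywhere R (gt t') (gts t') _ _ sk
  (fun r ri => (D t' r t'i ri).2).
exists t', s'; split => //; move: Et Es.
rewrite !(addrC _ k) !addrK => Et Es.
by rewrite -Es -Et; ring.
Qed.

(** Both mixed derivatives are limits of the same second difference quotient:
    two applications of the mean value theorem, in either order, express it by
    a value of each of them at some point of a small square. *)
Lemma schwarz_mixed (R : realType) (g gt gs gts gst : R -> R -> R) (t s d : R) :
  0 < d ->
  (forall t' s', t <= t' <= t + d -> s <= s' <= s + d ->
    [/\ is_derive t' 1 (fun r => g r s') (gt t' s'),
        is_derive s' 1 (gt t') (gts t' s'),
        is_derive s' 1 (g t') (gs t' s') &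
        is_derive t' 1 (fun r => gs r s') (gst t' s')]) ->
  {for (t, s), continuous (fun p : R * R => gts p.1 p.2)} ->
  {for (t, s), continuous (fun p : R * R => gst p.1 p.2)} ->
  gts t s = gst t s.
Proof.
move=> d0 D c1 c2; apply/eqP; rewrite -subr_eq0 -normr_le0.
apply/ler_addgt0Pr => e e0; rewrite add0r.
have e2 : 0 < e / 2 by rewrite divr_gt0.
move/cvgrPdist_lt: c1 => /(_ _ e2) /nbhs_ballP[/= k1 k10 n1].
move/cvgrPdist_lt: c2 => /(_ _ e2) /nbhs_ballP[/= k2 k20 n2].
pose k := Num.min d (Num.min (k1 / 2) (k2 / 2)).
have k0 : 0 < k by rewrite !lt_min d0 !divr_gt0.
have kd : k <= d by rewrite ge_min lexx.
have kk1 : k < k1 by rewrite !gt_min ltr_pdivrMr// ltr_pMr// ltr1n orbT.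
have kk2 : k < k2 by rewrite !gt_min [k2 / 2 < _]ltr_pdivrMr// ltr_pMr// ltr1n !orbT.
have wd (r x : R) : r <= x <= r + k -> r <= x <= r + d.
  by move=> /andP[-> h]; rewrite (le_trans h)// lerD2l.
have inb (K r x : R) : k < K -> r <= x <= r + k -> ball r K x.
  move=> kK /andP[rx xr]; rewrite /ball/= distrC ger0_norm ?subr_ge0//.
  by rewrite ltrBlDl (le_lt_trans xr)// ltrD2l.
have [|t1 [s1 [t1i s1i E1]]] :=
    @second_difference_mixed R g gt gts t s k (ltW k0).
  by move=> t' s' ti si; have [] := D t' s' (wd _ _ ti) (wd _ _ si).
have [|s2 [t2 [s2i t2i E2]]] :=
    @second_difference_mixed R (fun a b => g b a) (fun a b => gs b a)
      (fun a b => gst b a) s t k (ltW k0).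
  by move=> s' t' si ti; have [] := D t' s' (wd _ _ ti) (wd _ _ si).
have E : gts t1 s1 = gst t2 s2.
  apply: (@mulIf _ k); first exact: lt0r_neq0.
  apply: (@mulIf _ k); first exact: lt0r_neq0.
  by rewrite -E1 -E2; ring.
have h1 : `|gts t s - gts t1 s1| < e / 2.
  by apply: (n1 (t1, s1)); split => /=; apply: inb.
have h2 : `|gst t s - gst t2 s2| < e / 2.
  by apply: (n2 (t2, s2)); split => /=; apply: inb.
have -> : gts t s - gst t s = (gts t s - gts t1 s1) - (gst t s - gst t2 s2).
  by rewrite E; ring.
rewrite (le_trans (ler_normB _ _))// (splitr e).
by apply: ltW; apply: ltrD.
Qed.

(** The function exp(- C t) E(t) - eps t is nonincreasing. *)
Lemma gronwall_affine (R : realType) (E dE : R -> R) (T C eps : R) :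
  0 < T -> 0 <= C -> 0 <= eps -> continuous E ->
  (forall t, 0 < t < T -> is_derive t 1 E (dE t)) ->
  (forall t, 0 < t < T -> dE t <= C * E t + eps) ->
  E 0 <= 0 -> E T <= eps * T * expR (C * T).
Proof.
move=> T0 C0 e0 cE D dEle E0.
pose H (t : R) := expR (- C * t) * E t - eps * t.
pose dH (t : R) := expR (- C * t) * dE t + E t * (expR (- C * t) * - C) - eps.
have DH t : t \in `]0, T[%R -> is_derive t 1 H (dH t).
  rewrite in_itv/= => ti; have Dt := D t ti.
  apply: is_deriveB.
    have De : is_derive t 1 (fun t => expR (- C * t)) (expR (- C * t) * - C).
      apply: (@is_derive1_comp _ expR (fun t => - C * t)).
      have := is_deriveZ (- C) (is_derive_id t (1 : R)).
      by rewrite /GRing.scale/= mulr1.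
    apply: (is_derive_eq (is_deriveM De Dt)).
    rewrite /GRing.scale/=; ring.
  have := is_deriveZ eps (is_derive_id t (1 : R)).
  by rewrite /GRing.scale/= mulr1.
have cH : {within `[0, T], continuous H}.
  apply: continuous_subspaceT => t.
  apply: cvgB; last by apply: cvgM; [exact: cvg_cst|exact: cvg_id].
  apply: cvgM; last exact: cE.
  apply: (@continuous_comp _ _ _ (fun r => - C * r) expR); last exact: continuous_expR.
  by apply: cvgM; [exact: cvg_cst|exact: cvg_id].
have [t ti HE] := MVT T0 DH cH.
have tT : 0 < t < T by move: ti; rewrite in_itv.
have HT : H T <= H 0.
  rewrite -subr_le0 HE subr0 mulr_le0_ge0//; last exact: ltW.
  have -> : dH t = expR (- C * t) * (dE t - C * E t) - eps by rewrite /dH; ring.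
  rewrite subr_le0 (@le_trans _ _ (expR (- C * t) * eps))//.
    by rewrite ler_wpM2l ?expR_ge0// lerBlDl dEle.
  rewrite ler_piMl// -expR0 ler_expR mulNr oppr_le0 mulr_ge0//.
  by case/andP: tT => /ltW.
move: HT; rewrite /H !mulr0 expR0 mul1r subr0 => HT.
have : expR (- C * T) * E T <= eps * T.
  by rewrite -subr_le0 (le_trans HT).
by rewrite mulNr expRN ler_pdivrMl ?expR_gt0// mulrC.
Qed.

(** * Compactness and continuity *)

(** A bound that holds near every point, for all large enough constants, holds
    on a compact set for all large enough constants.  The conclusion is kept in
    the form of an eventual statement so that finitely many bounds can be
    satisfied by one constant. *)
Lemma compact_near_infty (R : realType) (T : topologicalType) (Q : set T)
    (P : R -> T -> Prop) :
  compact Q -> (forall x, Q x -> \forall y \near x & C \near +oo, P C y) ->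
  \forall C \near +oo, forall x, Q x -> P C x.
Proof. by move=> /compact_near_coveringP cQ locP; exact: cQ. Qed.

Lemma near_fst (X Y : topologicalType) (p : X) (q : Y) (P : X -> Prop) :
  (\forall x \near p, P x) -> \forall z \near (p, q), P z.1.
Proof.
move=> Pp; exists (P, setT); first by split => //; exact: filterT.
by move=> z [].
Qed.

Lemma near_snd (X Y : topologicalType) (p : X) (q : Y) (P : Y -> Prop) :
  (\forall x \near q, P x) -> \forall z \near (p, q), P z.2.
Proof.
move=> Pp; exists (setT, P); first by split => //; exact: filterT.
by move=> z [].
Qed.

Lemma cvg_to_pair (T X Y : topologicalType) (f : T -> X) (g : T -> Y) (t : T)
    (a : X) (b : Y) :
  f x @[x --> t] --> a -> g x @[x --> t] --> b ->
  (f x, g x) @[x --> t] --> (a, b).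
Proof. exact: cvg_pair. Qed.

Lemma near_bounded (R : realType) (T : topologicalType) (g : T -> R) (p : T) :
  {for p, continuous g} ->
  \forall q \near p, `|g q| <= `|g p| + 1.
Proof.
move=> /cvgrPdist_le/(_ 1 ltr01); apply: filterS => q h.
rewrite -(subrK (g p) (g q)) (le_trans (ler_normD _ _))// addrC lerD2l.
by rewrite distrC.
Qed.

Lemma compact_bounded_infty (R : realType) (T : topologicalType) (Q : set T)
    (g : T -> R) :
  compact Q -> continuous g -> \forall C \near +oo, forall x, Q x -> `|g x| <= C.
Proof.
move=> cQ cg; apply: compact_near_infty => // x _.
have h := near_bounded (cg x).
exists ([set y | `|g y| <= `|g x| + 1], [set C | `|g x| + 1 <= C]).
  by split => //=; apply: nbhs_pinfty_ge; rewrite num_real.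
by move=> [y C] /= [gy]; exact: le_trans.
Qed.

Lemma uniform_oscillation (R : realType) (n : nat) (g : R * 'rV[R]_n -> R)
    (Q : set (R * 'rV[R]_n)) (v : 'rV[R]_n) (eps : R) :
  compact Q -> continuous g -> 0 < eps ->
  \forall s \near (0 : R), forall p, Q p ->
    `|g (p.1, p.2 + s *: v) - g p| <= eps.
Proof.
move=> /compact_near_coveringP cQ cg e0.
have e2 : 0 < eps / 2 by rewrite divr_gt0.
have := cQ R (nbhs (0 : R)) (fun s p => `|g (p.1, p.2 + s *: v) - g p| <= eps) _.
apply=> p Qp.
  have cs : (fun z : (R * 'rV[R]_n) * R => (z.1.1, z.1.2 + z.2 *: v)) z @[z --> (p, 0)]
      --> (p.1, p.2 + 0 *: v).
    have c1 : z.1 @[z --> (p, 0 : R)] --> p by exact: cvg_fst.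
    have c2 : z.2 @[z --> (p, 0 : R)] --> (0 : R) by exact: cvg_snd.
    have c11 : z.1 @[z --> p] --> p.1 by case: (p) => ? ?; exact: cvg_fst.
    have c12 : z.2 @[z --> p] --> p.2 by case: (p) => ? ?; exact: cvg_snd.
    apply: cvg_to_pair; first exact: cvg_comp c1 c11.
    apply: cvgD; first exact: cvg_comp c1 c12.
    by apply: cvgZ => //; exact: cvg_cst.
  rewrite scale0r addr0 -surjective_pairing in cs.
  have h1 : \forall z \near (p, (0 : R)), `|g p - g (z.1.1, z.1.2 + z.2 *: v)| < eps / 2.
    have cgs : g (z.1.1, z.1.2 + z.2 *: v) @[z --> (p, (0 : R))] --> g p.
      exact: (@cvg_comp _ _ _ _ g _ _ _ cs (cg p)).
    by move/cvgrPdist_lt : cgs; apply.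
  have h2 : \forall z \near (p, (0 : R)), `|g p - g z.1| < eps / 2.
    apply: (@near_fst _ _ p (0 : R) (fun q => `|g p - g q| < eps / 2)).
    by move/cvgrPdist_lt: (cg p); apply.
  apply: filterS2 h1 h2 => -[q s] /= h1 h2.
  have -> : g (q.1, q.2 + s *: v) - g q =
    (g p - g q) - (g p - g (q.1, q.2 + s *: v)) by ring.
  by rewrite (le_trans (ler_normB _ _))// (splitr eps) ltW// ltrD.
Qed.

Lemma continuous_bigsum (R : realType) (T : topologicalType) (I : Type)
    (s : seq I) (h : I -> T -> R) :
  (forall i, continuous (h i)) -> continuous (fun y => \sum_(i <- s) h i y).
Proof.
move=> c; elim: s => [|i s IH].
  by under eq_fun do rewrite big_nil; move=> t; exact: cvg_cst.
by under eq_fun do rewrite big_cons; move=> t; apply: cvgD; [exact: c|exact: IH].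
Qed.

Lemma coord_le_norm (R : realType) (m : nat) (x : 'rV[R]_m) (i : 'I_m) :
  `|x 0 i| <= `|x|.
Proof.
rewrite [leRHS]/Num.norm/= mx_normrE; apply/bigmax_geP; right => /=.
by exists (0, i).
Qed.

Lemma norm_le_coord (R : realType) (m : nat) (x : 'rV[R]_m) (r : R) :
  0 <= r -> (forall i, `|x 0 i| <= r) -> `|x| <= r.
Proof.
move=> r0 xr; rewrite [leLHS]/Num.norm/= mx_normrE; apply: bigmax_le => //=.
by move=> [i j] _; rewrite (ord1 i).
Qed.

Lemma continuous_row (R : realType) (T : topologicalType) (m : nat)
    (U : T -> 'rV[R]_m) :
  (forall i, continuous (fun p => U p 0 i)) -> continuous U.
Proof.
move=> cU p; apply/cvgrPdist_le => e e0.
have H : \forall q \near p, forall i, `|U p 0 i - U q 0 i| <= e.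
  apply: (@filter_forall _ _ (fun i q => `|U p 0 i - U q 0 i| <= e)) => i.
  by move/cvgrPdist_le : (cU i p); apply.
apply: filterS H => q H; apply: norm_le_coord; first exact: ltW.
by move=> i; rewrite !mxE.
Qed.

Definition jointly_continuous (R : realType) (n : nat)
    (g : R -> 'rV[R]_n -> R) : Prop :=
  continuous (fun p : R * 'rV[R]_n => g p.1 p.2).

Section joint_continuity.
Context {R : realType} {n : nat}.
Implicit Types (g k : R -> 'rV[R]_n -> R).

Lemma jointly_continuousD g k : jointly_continuous g -> jointly_continuous k ->
  jointly_continuous (fun t x => g t x + k t x).
Proof. by move=> cg ck p; apply: cvgD; [exact: cg|exact: ck]. Qed.

Lemma jointly_continuousM g k : jointly_continuous g -> jointly_continuous k ->
  jointly_continuous (fun t x => g t x * k t x).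
Proof. by move=> cg ck p; apply: cvgM; [exact: cg|exact: ck]. Qed.

Lemma jointly_continuous_sqr g : jointly_continuous g ->
  jointly_continuous (fun t x => g t x ^+ 2).
Proof. by move=> cg p; apply: cvgM; exact: cg. Qed.

Lemma jointly_continuous_sum (I : Type) (s : seq I) (g : I -> R -> 'rV[R]_n -> R) :
  (forall i, jointly_continuous (g i)) ->
  jointly_continuous (fun t x => \sum_(i <- s) g i t x).
Proof.
move=> cg.
exact: (@continuous_bigsum _ _ _ s (fun i (p : R * 'rV[R]_n) => g i p.1 p.2)).
Qed.

Lemma jointly_continuous_time (f : R -> R) : continuous f ->
  jointly_continuous (fun t (_ : 'rV[R]_n) => f t).
Proof.
move=> cf p; apply: (@continuous_comp _ _ _ fst f); last exact: cf.
by case: (p) => ? ?; exact: cvg_fst.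
Qed.

Lemma jointly_continuous_slice g (x : 'rV[R]_n) : jointly_continuous g -> continuous (g ^~ x).
Proof.
move=> cg t; apply: (@continuous_comp _ _ _ (fun t => (t, x)) (fun p => g p.1 p.2)); last exact: cg.
by apply: cvg_to_pair; [exact: cvg_id|exact: cvg_cst].
Qed.

Lemma jointly_continuous_space g (t : R) : jointly_continuous g -> continuous (g t).
Proof.
move=> cg x; apply: (@continuous_comp _ _ _ (fun x => (t, x)) (fun p => g p.1 p.2)); last exact: cg.
apply: cvg_to_pair; last exact: cvg_id.
exact: (@cst_continuous _ _ t x).
Qed.

Lemma jointly_continuous_coord (l : 'I_n) :
  jointly_continuous (fun (t : R) (x : 'rV[R]_n) => x 0 l).
Proof.
move=> p; apply: (@continuous_comp _ _ _ snd (fun y : 'rV[R]_n => y 0 l)).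
  by case: (p) => ? ?; exact: cvg_snd.
exact: coord_continuous.
Qed.

End joint_continuity.

(** * Christoffel symbols are locally Lipschitz *)

Definition locally_lipschitz (R : realType) (V : normedModType R) (g : V -> R)
    (p : V) : Prop :=
  exists2 L, 0 <= L &
    \forall z \near (p, p), `|g z.1 - g z.2| <= L * `|z.1 - z.2|.

Section locally_lipschitz_theory.
Context {R : realType} {V : normedModType R}.
Implicit Types (g k : V -> R) (p : V).

Lemma locally_lipschitz_continuous g p :
  locally_lipschitz g p -> {for p, continuous g}.
Proof.
move=> [L L0 [[A B] /= [Ap Bp] AB]].
have pA : A p by exact: nbhs_singleton Ap.
apply/cvgrPdist_le => /= e e0.
have L1 : 0 < L + 1 by rewrite ltr_wpDl.
have Pe : \forall q \near p, `|p - q| < e / (L + 1).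
  have : (id x @[x --> p]) --> p by exact: cvg_id.
  by move/cvgrPdist_lt; apply; rewrite divr_gt0.
near=> q; apply: (le_trans (AB (p, q) _)).
  by split => //=; near: q.
rewrite /= (@le_trans _ _ ((L + 1) * `|p - q|))//.
  by rewrite ler_wpM2r// lerDl.
by rewrite mulrC -ler_pdivlMr// ltW//; near: q.
Unshelve. all: by end_near. Qed.

Lemma locally_lipschitz_cst (c : R) p : locally_lipschitz (fun=> c) p.
Proof.
by exists 0 => //; near=> z; rewrite subrr normr0 mul0r.
Unshelve. all: by end_near. Qed.

Lemma locally_lipschitzD g k p : locally_lipschitz g p ->
  locally_lipschitz k p -> locally_lipschitz (fun x => g x + k x) p.
Proof.
move=> [L L0 gL] [K K0 kK]; exists (L + K); first exact: addr_ge0.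
apply: filterS2 gL kK => z gz kz.
have -> : g z.1 + k z.1 - (g z.2 + k z.2) = (g z.1 - g z.2) + (k z.1 - k z.2).
  by ring.
by rewrite (le_trans (ler_normD _ _))// mulrDl lerD.
Qed.

Lemma locally_lipschitzM g k p : locally_lipschitz g p ->
  locally_lipschitz k p -> locally_lipschitz (fun x => g x * k x) p.
Proof.
move=> gl kl; have gb := near_bounded (locally_lipschitz_continuous gl).
have kb := near_bounded (locally_lipschitz_continuous kl).
move: gl kl => [L L0 gL] [K K0 kK].
exists ((`|g p| + 1) * K + (`|k p| + 1) * L).
  by rewrite addr_ge0 ?mulr_ge0 ?addr_ge0.
move/(near_fst p) : gb => gb; move/(near_snd p) : kb => kb.
near=> z.
have -> : g z.1 * k z.1 - g z.2 * k z.2 =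
    g z.1 * (k z.1 - k z.2) + k z.2 * (g z.1 - g z.2) by ring.
rewrite (le_trans (ler_normD _ _))// mulrDl !normrM -!mulrA lerD//.
  by apply: ler_pM => //; near: z.
by apply: ler_pM => //; near: z.
Unshelve. all: by end_near. Qed.

Lemma locally_lipschitzV g p : g p != 0 -> locally_lipschitz g p ->
  locally_lipschitz (fun x => (g x)^-1) p.
Proof.
move=> g0 gl; have c := locally_lipschitz_continuous gl.
have a0 : 0 < `|g p| by rewrite normr_gt0.
have a20 : 0 < `|g p| / 2 by rewrite divr_gt0.
have lb : \forall q \near p, `|g p| / 2 <= `|g q|.
  move/cvgrPdist_le: c => /(_ _ a20); apply: filterS => q h.
  rewrite [leLHS](_ : _ = `|g p| - `|g p| / 2); last by lra.
  by rewrite lerBlDr -lerBlDl (le_trans _ h)// lerB_dist.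
move: gl => [L L0 gL].
exists ((`|g p| / 2) ^- 2 * L).
  by apply: mulr_ge0 => //; rewrite invr_ge0; exact/exprn_ge0/ltW.
have lb1 := near_fst p lb; have lb2 := near_snd p lb.
near=> z.
have z1 : `|g p| / 2 <= `|g z.1| by near: z.
have z2 : `|g p| / 2 <= `|g z.2| by near: z.
have z10 : 0 < `|g z.1| by exact: lt_le_trans z1.
have z20 : 0 < `|g z.2| by exact: lt_le_trans z2.
have -> : (g z.1)^-1 - (g z.2)^-1 = (g z.1 * g z.2)^-1 * (g z.2 - g z.1).
  by field; rewrite -!normr_gt0 z10 z20.
rewrite normrM distrC -mulrA; apply: ler_pM => //; last by near: z.
rewrite normfV normrM lef_pV2 ?posrE ?exprn_gt0 ?mulr_gt0//.
by rewrite expr2 ler_pM// ltW.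
Unshelve. all: by end_near. Qed.

Lemma locally_lipschitz_sum (I : Type) (s : seq I) (P : pred I) (g : I -> V -> R) p :
  (forall i, locally_lipschitz (g i) p) ->
  locally_lipschitz (fun x => \sum_(i <- s | P i) g i x) p.
Proof.
move=> gl; elim: s => [|i s IH].
  by under eq_fun do rewrite big_nil; exact: locally_lipschitz_cst.
under eq_fun do rewrite big_cons.
by case: (P i) => //; exact: locally_lipschitzD.
Qed.

Lemma locally_lipschitz_prod (I : Type) (s : seq I) (P : pred I) (g : I -> V -> R) p :
  (forall i, locally_lipschitz (g i) p) ->
  locally_lipschitz (fun x => \prod_(i <- s | P i) g i x) p.
Proof.
move=> gl; elim: s => [|i s IH].
  by under eq_fun do rewrite big_nil; exact: locally_lipschitz_cst.
under eq_fun do rewrite big_cons.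
by case: (P i) => //; exact: locally_lipschitzM.
Qed.

Lemma locally_lipschitz_det (m : nat) (A : V -> 'M[R]_m) p :
  (forall i j, locally_lipschitz (fun x => A x i j) p) ->
  locally_lipschitz (fun x => \det (A x)) p.
Proof.
move=> Al; rewrite /determinant; apply: locally_lipschitz_sum => s.
apply: locally_lipschitzM; first exact: locally_lipschitz_cst.
exact: locally_lipschitz_prod.
Qed.

Lemma near_eq_locally_lipschitz g k p : (\forall q \near p, g q = k q) ->
  locally_lipschitz g p -> locally_lipschitz k p.
Proof.
move=> gk [L L0 gL]; exists L => //.
have e1 := near_fst p gk; have e2 := near_snd p gk.
by near=> z; rewrite -(near e1 z)// -(near e2 z)//; near: z.
Unshelve. all: by end_near. Qed.

(** Cramer's rule writes the entries of the inverse as rational functions of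
    the entries of the matrix. *)
Lemma locally_lipschitz_invmx (m : nat) (A : V -> 'M[R]_m) p (i j : 'I_m) :
  (\forall q \near p, A q \in unitmx) ->
  (forall i j, locally_lipschitz (fun x => A x i j) p) ->
  locally_lipschitz (fun x => invmx (A x) i j) p.
Proof.
move=> Au Al.
apply: (@near_eq_locally_lipschitz
    (fun x => (\det (A x))^-1 * cofactor (A x) j i)).
  by apply: filterS Au => q qu; rewrite /invmx qu !mxE.
apply: locally_lipschitzM.
  apply: locally_lipschitzV; last exact: locally_lipschitz_det.
  by move/nbhs_singleton: Au; rewrite unitmxE unitfE.
apply: locally_lipschitzM; first exact: locally_lipschitz_cst.
apply: locally_lipschitz_det => k l.
by under eq_fun do rewrite !mxE; exact: Al.
Qed.

End locally_lipschitz_theory.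

(** A box is a ball for the sup norm, so that one can walk from [q] to [q']
    inside it by changing one coordinate at a time; each step is controlled by
    one partial derivative. *)
Lemma lipschitz_on_box (R : realType) (m : nat) (g : 'rV[R]_m -> R)
    (p : 'rV[R]_m) (d M : R) :
  (forall q, `|p - q| < d -> forall j : 'I_m,
     derivable g q (delta_mx 0 j) /\ `|partial j g q| <= M) ->
  forall q q', `|p - q| < d -> `|p - q'| < d ->
    `|g q - g q'| <= m%:R * M * `|q - q'|.
Proof.
move=> D q q' qd q'd.
have d0 : 0 < d by exact: le_lt_trans qd.
pose z k : 'rV[R]_m := \row_j (if (j < k)%N then q' 0 j else q 0 j).
have coordlt (x : 'rV[R]_m) : (forall j, `|p 0 j - x 0 j| < d) -> `|p - x| < d.
  move=> H; pose e := \big[Num.max/0]_j `|p 0 j - x 0 j|.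
  have ed : e < d by apply: bigmax_lt.
  apply: le_lt_trans ed; apply: norm_le_coord; first exact: bigmax_ge_id.
  by move=> j; rewrite !mxE; exact: le_bigmax.
have qj j : `|p 0 j - q 0 j| < d.
  by apply: le_lt_trans qd; have := coord_le_norm (p - q) j; rewrite !mxE.
have q'j j : `|p 0 j - q' 0 j| < d.
  by apply: le_lt_trans q'd; have := coord_le_norm (p - q') j; rewrite !mxE.
suff H k : (k <= m)%N -> `|g q - g (z k)| <= k%:R * M * `|q - q'|.
  have -> : q' = z m by apply/rowP => j; rewrite mxE ltn_ord.
  have -> : q - z m = q - q' by congr (_ - _); apply/rowP => j; rewrite mxE ltn_ord.
  exact: H.
elim: k => [_|k IH km].
  have -> : z 0%N = q by apply/rowP => j; rewrite mxE.
  by rewrite subrr normr0 !mul0r.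
pose j := Ordinal km; pose c := q' 0 j - q 0 j.
have zE s : 0 <= s <= 1 -> `|p - (z k + s *: (c *: delta_mx 0 j))| < d.
  move=> /andP[s0 s1]; apply: coordlt => i; rewrite !mxE/=.
  have [->|ij] := eqVneq i j; last first.
    by rewrite !mulr0 addr0; case: ifP.
  rewrite /= ltnn mulr1 /c.
  have -> : p 0 j - (q 0 j + s * (q' 0 j - q 0 j)) =
    (1 - s) * (p 0 j - q 0 j) + s * (p 0 j - q' 0 j) by ring.
  rewrite (le_lt_trans (ler_normD _ _))// !normrM (ger0_norm s0)
    (@ger0_norm _ (1 - s)) ?subr_ge0//.
  have [s_0|s_0] := eqVneq s 0; first by rewrite s_0 subr0 mul1r mul0r addr0.
  have sp : 0 < s by rewrite lt_neqAle eq_sym s_0.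
  have -> : d = (1 - s) * d + s * d by ring.
  by apply: ler_ltD; [rewrite ler_wpM2l ?subr_ge0//; exact: ltW|rewrite ltr_pM2l].
have zS : z k.+1 = z k + 1 *: (c *: delta_mx 0 j).
  apply/rowP => i; rewrite !mxE eqxx/= ltnS leq_eqVlt mul1r.
  have [->|ij] := eqVneq i j; first by rewrite /= eqxx ltnn mulr1 /c addrC subrK.
  have ik : (i == k :> nat) = false by apply: contra_neqF ij => /eqP e; exact/val_inj.
  by rewrite ik mulr0 addr0.
have [|s s01 E] := @MVT_everywhere R (fun s => g (z k + s *: (c *: delta_mx 0 j)))
   (fun s => c * partial j g (z k + s *: (c *: delta_mx 0 j))) 0 1 ler01.
  move=> s s01; have [dg _] := D _ (zE s s01) j.
  have := derivableP dg; rewrite -/(partial j g _) scalerA => /is_derive_lineP Dg.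
  under eq_fun do rewrite scalerA.
  rewrite (mulrC c).
  apply: (@is_derive1_comp _ (fun r => g (z k + r *: delta_mx 0 j)) (fun s => s * c)) => //.
  apply: (is_derive_eq (is_deriveM (is_derive_id s (1 : R)) (is_derive_cst c s 1))).
  by rewrite /GRing.scale/= mulr0 add0r mulr1.
move: E; rewrite -zS scale0r addr0 subr0 mulr1 => E.
have [_ dM] := D _ (zE s s01) j.
have cq : `|c| <= `|q - q'|.
  by rewrite /c distrC; have := coord_le_norm (q - q') j; rewrite !mxE.
have -> : g q - g (z k.+1) = (g q - g (z k)) - (g (z k.+1) - g (z k)) by ring.
rewrite (le_trans (ler_normB _ _))// -natr1 !mulrDl mul1r.
apply: lerD; first exact: IH (ltnW km).
by rewrite E normrM mulrC ler_pM.
Qed.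

Lemma Ck1_locally_lipschitz (R : realType) (m : nat) (D : set 'rV[R]_m)
    (g : 'rV[R]_m -> R) (p : 'rV[R]_m) :
  open D -> D p -> Ck D 1 g -> locally_lipschitz g p.
Proof.
move=> oD Dp [_ /= dg].
pose M := \sum_j (`|partial j g p| + 1).
have nearD : \forall q \near p, D q by exact: open_nbhs_nbhs.
have nearM : \forall q \near p, forall j, `|partial j g q| <= M.
  apply: (@filter_forall _ _ (fun j q => `|partial j g q| <= M) (nbhs p)) => j.
  have [_ [cg _]] := dg j.
  have := near_bounded (cg p (mem_set Dp)); apply: filterS => q h.
  apply: (le_trans h); rewrite /M (bigD1 j)//= lerDl.
  by apply: sumr_ge0 => i _; exact: addr_ge0.
have /nbhs_ballP[d d0 bd] : \forall q \near p, D q /\ forall j, `|partial j g q| <= M.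
  by apply: filterS2 nearD nearM.
exists (m%:R * M); first by rewrite mulr_ge0// sumr_ge0// => i _; rewrite addr_ge0.
have pb : \forall q \near p, `|p - q| < d.
  have := nbhsx_ballx p d d0; apply: filterS => q; by rewrite -ball_normE.
have b1 := near_fst p pb; have b2 := near_snd p pb.
near=> z.
have z1 : `|p - z.1| < d by near: z.
have z2 : `|p - z.2| < d by near: z.
apply: (@lipschitz_on_box _ _ _ p d) => //.
move=> q qd j; have [Dq qM] : D q /\ forall j, `|partial j g q| <= M.
  by apply: bd; rewrite -ball_normE.
by split=> //; apply: (dg j).1; exact: mem_set.
Unshelve. all: by end_near. Qed.

(** A vector in the kernel of [h u] would have length zero. *)
Lemma metric_unitmx (R : realType) (m : nat) (Omega : set 'rV[R]_m)
    (h : 'rV[R]_m -> 'M[R]_m) (u : 'rV[R]_m) :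
  riemannian_chart Omega h -> Omega u -> h u \in unitmx.
Proof.
move=> ch Ou; rewrite -row_free_unit -kermx_eq0; apply/eqP/row_matrixP => i.
rewrite row0; apply/eqP/negP => /negP k0.
have := metric_pos ch Ou k0.
by rewrite -row_mul mulmx_ker row0 mul0mx mxE ltxx.
Qed.

Lemma christoffel_locally_lipschitz (R : realType) (m : nat)
    (Omega : set 'rV[R]_m) (h : 'rV[R]_m -> 'M[R]_m) (i j k : 'I_m)
    (u : 'rV[R]_m) :
  riemannian_chart Omega h -> Omega u ->
  locally_lipschitz (christoffel h i j k) u.
Proof.
move=> ch Ou; have oO := chart_open ch.
have hl a b : locally_lipschitz (fun v => h v a b) u.
  exact: (Ck1_locally_lipschitz oO Ou (metric_smooth ch a b 1%N)).
have dhl c a b : locally_lipschitz (partial c (fun v => h v a b)) u.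
  apply: (Ck1_locally_lipschitz oO Ou).
  by have [_ /(_ c)[]] := metric_smooth ch a b 2%N.
apply: locally_lipschitzM; first exact: locally_lipschitz_cst.
apply: locally_lipschitz_sum => l.
apply: locally_lipschitzM.
  apply: locally_lipschitz_invmx => //.
  have : \forall q \near u, Omega q by exact: open_nbhs_nbhs.
  by apply: filterS => q; exact: metric_unitmx.
apply: locally_lipschitzD; first exact: locally_lipschitzD.
under eq_fun do rewrite -mulN1r.
by apply: locally_lipschitzM; first exact: locally_lipschitz_cst.
Qed.

(** The chart need not be convex, so the segment from [U x] to [V x] may leave
    it and no mean value theorem applies globally.  Near a point with
    [U x = V x] the local Lipschitz bound is enough; near any other point the
    distance from [U] to [V] is bounded below, and a bound on [g] suffices. *)
Lemma compact_lipschitz_infty (R : realType) (T : topologicalType) (m : nat)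
    (Q : set T) (g : 'rV[R]_m -> R) (U V : T -> 'rV[R]_m) :
  compact Q -> continuous U -> continuous V ->
  (forall x, locally_lipschitz g (U x)) -> (forall x, locally_lipschitz g (V x)) ->
  \forall C \near +oo, forall x, Q x -> `|g (U x) - g (V x)| <= C * `|U x - V x|.
Proof.
move=> cQ cU cV lU lV; apply: compact_near_infty => // x _.
have [UV|UV] := eqVneq (U x) (V x).
  have [L L0 HL] := lU x.
  have cUV : (U y, V y) @[y --> x] --> (U x, U x).
    by apply: cvg_to_pair; [exact: cU|rewrite UV; exact: cV].
  have h : \forall y \near x, `|g (U y) - g (V y)| <= L * `|U y - V y|.
    exact: (cUV _ HL).
  exists ([set y | `|g (U y) - g (V y)| <= L * `|U y - V y|], [set C | L <= C]).
    by split => //=; apply: nbhs_pinfty_ge; rewrite num_real.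
  by move=> [y C] /= [gy LC]; rewrite (le_trans gy)// ler_wpM2r.
pose d := `|U x - V x|; have d0 : 0 < d by rewrite normr_gt0 subr_eq0.
have cgU : {for x, continuous (g \o U)}.
  by apply: continuous_comp; [exact: cU|exact: locally_lipschitz_continuous].
have cgV : {for x, continuous (g \o V)}.
  by apply: continuous_comp; [exact: cV|exact: locally_lipschitz_continuous].
have hU := near_bounded cgU; have hV := near_bounded cgV.
have d20 : 0 < d / 2 by rewrite divr_gt0.
have hd : \forall y \near x, d / 2 <= `|U y - V y|.
  have cN : {for x, continuous (fun y => U y - V y)} by apply: cvgB; [exact: cU|exact: cV].
  move/cvgrPdist_le: cN => /(_ _ d20); apply: filterS => y h.
  have := lerB_dist (U x - V x) (U y - V y); rewrite -/d; lra.
pose M := (`|g (U x)| + 1) + (`|g (V x)| + 1).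
have M0 : 0 <= M by rewrite !addr_ge0.
exists ([set y | `|g (U y) - g (V y)| <= M /\ d / 2 <= `|U y - V y|],
        [set C | M / (d / 2) <= C]).
  split => //=; last by apply: nbhs_pinfty_ge; rewrite num_real.
  apply: filterS3 hU hV hd => y hU hV hd; split => //.
  by rewrite (le_trans (ler_normB _ _))// lerD.
move=> [y C] /= [[gy dy] MC]; rewrite (le_trans gy)//.
have C0 : 0 <= C by rewrite (le_trans _ MC)// divr_ge0// ltW.
apply: (@le_trans _ _ (C * (d / 2))); first by rewrite -ler_pdivrMr.
by rewrite ler_wpM2l.
Qed.

(** * Sums over a periodic grid *)

Section grid.
Context {R : realType} {n : nat} (N : nat) (r : R).
Implicit Types (k : {ffun 'I_n -> 'I_N}) (l : 'I_n).

Definition mesh : R := 2 * r / N%:R.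

Definition grid_point k : 'rV[R]_n := \row_l (- r + mesh * (k l)%:R).

(** Since [ordS] is cyclic, the shift wraps around: the faces x_l = - r and
    x_l = r of the cube are identified. *)
Definition grid_shift l k : {ffun 'I_n -> 'I_N} :=
  [ffun i => if i == l then ordS (k i) else k i].

Lemma grid_shift_inj l : injective (grid_shift l).
Proof.
move=> k k' /ffunP e; apply/ffunP => i; have := e i; rewrite !ffunE.
by case: ifP => // _; exact: ordS_inj.
Qed.

Lemma grid_point_bound k : 0 <= r -> forall l, `|grid_point k 0 l| <= r.
Proof.
move=> r0 l; rewrite mxE /mesh ler_norml lerDl.
have N0 : 0 < N%:R :> R by rewrite ltr0n; case: N (k l) => [[]|].
have kN : (k l)%:R <= N%:R :> R by rewrite ler_nat ltnW.
have m0 : 0 <= 2 * r / N%:R by rewrite divr_ge0 ?mulr_ge0// ltW.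
rewrite mulr_ge0//= addrC lerBlDr (@le_trans _ _ (2 * r / N%:R * N%:R))//.
  by rewrite ler_wpM2l.
by rewrite divfK ?gt_eqF//; lra.
Qed.

(** Translation by one mesh is the cyclic shift of the index, except at the
    last layer of the grid; there the translated point and the point reached by
    wrapping around lie on opposite faces, where [P] vanishes. *)
Lemma sum_grid_translate (P : 'rV[R]_n -> R) l :
  (forall x : 'rV[R]_n, `|x 0 l| = `|r| -> P x = 0) ->
  \sum_(k : {ffun 'I_n -> 'I_N}) P (grid_point k + mesh *: delta_mx 0 l) =
  \sum_(k : {ffun 'I_n -> 'I_N}) P (grid_point k).
Proof.
move=> P0; rewrite [RHS](reindex_inj (@grid_shift_inj l)) /=.
apply: eq_bigr => k _.
have [kN|kN] := ltnP (k l).+1 N.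
  congr P; apply/rowP => i; rewrite !mxE ffunE /=.
  have [->|il] := eqVneq i l; last by rewrite mulr0 addr0.
  by rewrite /= modn_small// mulr1 -addrA -natr1 mulrDr mulr1.
have kE : (k l).+1 = N by apply/eqP; rewrite eqn_leq kN ltn_ord.
have N0 : N%:R != 0 :> R by rewrite -kE pnatr_eq0.
rewrite !P0//.
  by rewrite mxE ffunE eqxx /= kE modnn mulr0 addr0 normrN.
rewrite !mxE !eqxx mulr1 -addrA -[X in _ + (_ + X)]mulr1 -mulrDr natr1 kE /mesh.
by rewrite divfK//; congr `|_|; ring.
Qed.

(** The discrete divergence theorem: the difference quotients of [P l] in the
    direction [l] add up to zero, and each of them is a value of the derivative
    [dP l] within one mesh of the grid point. *)
Lemma grid_divergence (P dP : 'I_n -> 'rV[R]_n -> R) (eps : R) :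
  (0 < N)%N -> 0 < r ->
  (forall l x, is_derive x (delta_mx 0 l) (P l) (dP l x)) ->
  (forall l (x : 'rV[R]_n), `|x 0 l| = r -> P l x = 0) ->
  (forall l (x : 'rV[R]_n) s, (forall i, `|x 0 i| <= r) -> 0 <= s <= mesh ->
     `|dP l (x + s *: delta_mx 0 l) - dP l x| <= eps) ->
  \sum_(k : {ffun 'I_n -> 'I_N}) \sum_l dP l (grid_point k) <=
    (#|{ffun 'I_n -> 'I_N}| * n)%:R * eps.
Proof.
move=> N0 r0 D P0 osc.
have m0 : 0 < mesh by rewrite divr_gt0 ?mulr_gt0// ltr0n.
have step l (x : 'rV[R]_n) : (forall i, `|x 0 i| <= r) ->
    dP l x <= (P l (x + mesh *: delta_mx 0 l) - P l x) / mesh + eps.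
  move=> xr.
  have [|s sm] := @MVT_everywhere R (fun s => P l (x + s *: delta_mx 0 l))
     (fun s => dP l (x + s *: delta_mx 0 l)) 0 mesh (ltW m0).
    by move=> s _; have /is_derive_lineP := D l (x + s *: delta_mx 0 l).
  rewrite scale0r addr0 subr0 => ->; rewrite mulfK ?gt_eqF//.
  have := osc l x s xr sm; rewrite ler_norml => /andP[+ _]; lra.
rewrite exchange_big/=.
apply: (@le_trans _ _ (\sum_(l < n) #|{ffun 'I_n -> 'I_N}|%:R * eps)); last first.
  by rewrite sumr_const card_ord natrM -[leLHS]mulr_natl -[leRHS]mulrA -[leRHS]mulrCA.
apply: ler_sum => l _.
apply: (@le_trans _ _ (\sum_(k : {ffun 'I_n -> 'I_N})
    ((P l (grid_point k + mesh *: delta_mx 0 l) - P l (grid_point k)) / mesh + eps))).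
  by apply: ler_sum => k _; apply: step; exact/grid_point_bound/ltW.
rewrite big_split/= sumr_const mulr_natl -mulr_suml big_split/= sumrN.
rewrite sum_grid_translate ?subrr ?mul0r ?add0r//.
by move=> x; rewrite [`|r|]gtr0_norm//; exact: P0.
Qed.

End grid.

(** With [2 * M * J] points per axis, the [J] consecutive indices that start at
    the centre [M * J] give points of the cube [0, r / M]^n; these [J ^ n] grid
    points are a fixed fraction of the whole grid, whatever [J] is. *)
Lemma grid_mass (R : realType) (n M J : nat) (r delta : R) (e : 'rV[R]_n -> R) :
  (0 < M)%N -> (0 < J)%N -> 0 < r -> 
  (forall x, 0 <= e x) ->
  (forall x, `|x| <= r / M%:R -> delta <= e x) ->
  (J ^ n)%:R * delta <=
    \sum_(k : {ffun 'I_n -> 'I_(2 * M * J)}) e (grid_point r k).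
Proof.
move=> M0 J0 r0 e0 ed.
have lt_idx (j : 'I_J) : (M * J + j < 2 * M * J)%N.
  have : (j < M * J)%N by rewrite (leq_trans (ltn_ord j))// leq_pmull.
  by rewrite -mulnA mul2n -addnn ltn_add2l.
pose emb (j : {ffun 'I_n -> 'I_J}) : {ffun 'I_n -> 'I_(2 * M * J)} :=
  [ffun i => Ordinal (lt_idx (j i))].
have emb_inj : injective emb.
  move=> j j' /ffunP E; apply/ffunP => i; have := E i; rewrite !ffunE.
  by move=> /(congr1 val)/= /addnI; exact: val_inj.
rewrite (bigID (mem (emb @: [set: {ffun 'I_n -> 'I_J}]%SET)))/=.
rewrite -[leLHS]addr0 lerD ?sumr_ge0//.
rewrite big_imset/=; last by move=> ? ? _ _; exact: emb_inj.
have -> : (J ^ n)%:R * delta = \sum_(j in [set: {ffun 'I_n -> 'I_J}]%SET) delta.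
  by rewrite sumr_const cardsT card_ffun !card_ord mulr_natl.
apply: ler_sum => j _; apply: ed; apply: norm_le_coord.
  by rewrite divr_ge0// ltW.
move=> i; rewrite mxE ffunE/= /mesh.
have MJ : M%:R != 0 :> R /\ J%:R != 0 :> R by rewrite !pnatr_eq0 -!lt0n.
have -> : - r + 2 * r / (2 * M * J)%:R * (M * J + j i)%:R = r / M%:R * ((j i)%:R / J%:R).
  by rewrite !natrM natrD natrM; field; case: MJ => -> ->.
rewrite ger0_norm; last by rewrite mulr_ge0 ?divr_ge0// ltW.
rewrite ler_piMr//; first by rewrite divr_ge0// ltW.
by rewrite ler_pdivrMr ?ltr0n// mul1r ler_nat ltnW.
Qed.

(** * The shrinking cutoff *)

Section cutoff.
Context {R : realType} {n : nat} (r K : R).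

Definition tent (t : R) (x : 'rV[R]_n) : R :=
  Num.max 0 (r ^+ 2 - K * t - \sum_l x 0 l ^+ 2).

(** The square makes the truncation at zero differentiable. *)
Definition cutoff (t : R) (x : 'rV[R]_n) : R := tent t x ^+ 2.

Lemma tent_ge0 t x : 0 <= tent t x.
Proof. by rewrite le_max lexx. Qed.

Lemma is_derive_cutoff_time (t : R) x :
  is_derive t 1 (cutoff ^~ x) (- (2 * K * tent t x)).
Proof.
have Dl : is_derive t 1 (fun t : R => r ^+ 2 - K * t - \sum_l x 0 l ^+ 2) (- K).
  have := is_derive_add (is_derive_add (is_derive_cst (r ^+ 2) t 1)
    (is_derive_mul (is_derive_cst (- K) t 1) (is_derive_id t (1 : R))))
    (is_derive_cst (- \sum_l x 0 l ^+ 2) t 1).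
  rewrite mul0r mulr1 !add0r addr0.
  by under eq_fun do rewrite /= mulNr.
have := is_derive_comp1 (is_derive_pos_sqr _) Dl.
by rewrite -/(tent t x) mulrN mulrAC.
Qed.

Lemma is_derive_cutoff_space t (x : 'rV[R]_n) l :
  is_derive x (delta_mx 0 l) (cutoff t) (- (4 * tent t x * x 0 l)).
Proof.
have Dl : is_derive x (delta_mx 0 l)
    (fun y : 'rV[R]_n => r ^+ 2 - K * t - \sum_j y 0 j ^+ 2) (- (2 * x 0 l)).
  have -> : 2 * x 0 l = \sum_j 2 * x 0 j * (delta_mx 0 l : 'rV[R]_n) 0 j.
    rewrite (bigD1 l)//= mxE !eqxx mulr1 big1 ?addr0// => j jl.
    by rewrite mxE (negbTE jl) andbF mulr0.
  apply: (is_derive_eq (is_deriveB (is_derive_cst _ x _) (is_derive_bigsum _ _))).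
    by move=> j; apply: is_derive_sqr; exact: is_derive_coord.
  by rewrite sub0r.
have := is_derive_comp1 (is_derive_pos_sqr _) Dl.
by rewrite -/(tent t x); congr is_derive; ring.
Qed.

Lemma tent_continuous : jointly_continuous tent.
Proof.
have cm : continuous (fun y : R => Num.max 0 y).
  move=> y; apply: continuous_max; [exact: cvg_cst|exact: cvg_id].
move=> p; apply: (@continuous_comp _ _ _
  (fun p : R * 'rV[R]_n => r ^+ 2 - K * p.1 - \sum_l p.2 0 l ^+ 2)
  (fun y : R => Num.max 0 y)); last exact: cm.
apply: cvgB.
  apply: cvgB; first exact: cvg_cst.
  by apply: cvgM; [exact: cvg_cst|case: (p) => ? ?; exact: cvg_fst].
have : jointly_continuous (fun (t : R) (x : 'rV[R]_n) => \sum_l x 0 l ^+ 2).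
  apply: jointly_continuous_sum => l; apply: jointly_continuous_sqr.
  exact: jointly_continuous_coord.
exact.
Qed.

Lemma cutoff_continuous : jointly_continuous cutoff.
Proof. by apply: jointly_continuous_sqr; exact: tent_continuous. Qed.

Lemma cutoff_boundary t (x : 'rV[R]_n) l : 0 <= K * t -> `|x 0 l| = `|r| -> cutoff t x = 0.
Proof.
move=> Kt xr; rewrite /cutoff /tent max_l ?expr0n//.
rewrite (bigD1 l)//= -(real_normK (num_real (x 0 l))) xr real_normK ?num_real//.
have : 0 <= \sum_(i < n | i != l) x 0 i ^+ 2.
  by apply: sumr_ge0 => i _; exact: sqr_ge0.
lra.
Qed.

End cutoff.

(** * Local energy estimate *)

(** The contribution of one component to d_t (chi e) <= div (flux) + C chi e,
    at one point, with [M] the value of [tent] and [v], [p] the time and space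
    derivatives of [w].  After cancellation of the second derivatives through
    the divergence, the term 8 beta M v (x . p) remains; it is at most
    4 beta M r (n v^2 + |p|^2), which is what the speed [2 * r * (B1 n + 1)]
    of the cutoff pays for. *)
Lemma energy_density_growth (R : realType) (n : nat) (x : 'rV[R]_n)
    (r M w v vt beta dbeta b0 B1 C e1 : R) (p pt pp : 'I_n -> R) :
  0 <= r -> (forall l, `|x 0 l| <= r) -> 0 <= M ->
  0 < b0 -> b0 <= beta -> beta <= B1 -> `|dbeta| <= B1 ->
  v * (vt - beta * \sum_l pp l) <= C * e1 ->
  - (2 * (2 * r * (B1 * n%:R + 1)) * M) * (w ^+ 2 + v ^+ 2 + beta * \sum_l p l ^+ 2)
  + M ^+ 2 * (2 * w * v + 2 * v * vt + dbeta * (\sum_l p l ^+ 2)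
              + beta * \sum_l 2 * p l * pt l)
  <= \sum_l (2 * beta * (- (4 * M * x 0 l) * (v * p l)
                         + M ^+ 2 * (pt l * p l + v * pp l)))
     + M ^+ 2 * (w ^+ 2 + v ^+ 2 + 2 * (C * e1)
                 + B1 / b0 * (beta * \sum_l p l ^+ 2)).
Proof.
move=> r0 xr M0 b00 b0b bB dB vN.
have beta0 : 0 < beta by exact: lt_le_trans b0b.
set P2 := \sum_l p l ^+ 2.
have P20 : 0 <= P2 by apply: sumr_ge0 => l _; exact: sqr_ge0.
pose G := \sum_l x 0 l * p l.
have -> : \sum_l (2 * beta * (- (4 * M * x 0 l) * (v * p l)
                         + M ^+ 2 * (pt l * p l + v * pp l))) =
  - (8 * beta * M * (v * G)) + M ^+ 2 * (beta * (\sum_l 2 * p l * pt l)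
    + 2 * v * (beta * \sum_l pp l)).
  rewrite /G !mulr_sumr -big_split/= !mulr_sumr -sumrN -big_split/=.
  by apply: eq_bigr => l _; ring.
have vG : 2 * (v * G) <= r * (n%:R * v ^+ 2 + P2).
  have -> : n%:R * v ^+ 2 = \sum_(l < n) v ^+ 2.
    by rewrite sumr_const card_ord mulr_natl.
  rewrite -big_split/= /G !mulr_sumr; apply: ler_sum => l _.
  apply: (@le_trans _ _ (r * (2 * `|v * p l|))).
    rewrite (le_trans (ler_norm _))// !normrM normr_nat.
    rewrite [leLHS](_ : _ = `|x 0 l| * (2 * (`|v| * `|p l|))); last by ring.
    by rewrite ler_wpM2r ?mulr_ge0.
  rewrite ler_wpM2l// normrM -[v ^+ 2]real_normK ?num_real// -[p l ^+ 2]real_normK ?num_real//.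
  have := sqr_ge0 (`|v| - `|p l|); nra.
have dP : dbeta * P2 <= B1 / b0 * (beta * P2).
  have B10 : 0 <= B1 by rewrite (le_trans _ dB).
  rewrite mulrA ler_wpM2r// (le_trans (ler_norm _))// (le_trans dB)//.
  by rewrite mulrAC -mulrA ler_peMr// ler_pdivlMr// mul1r.
have flux : 8 * beta * M * (v * G) <=
    2 * (2 * r * (B1 * n%:R + 1)) * M * (v ^+ 2 + beta * P2).
  rewrite [leLHS](_ : _ = 4 * beta * M * (2 * (v * G))); last by ring.
  apply: (@le_trans _ _ (4 * beta * M * (r * (n%:R * v ^+ 2 + P2)))).
    by rewrite ler_wpM2l// !mulr_ge0// ltW.
  rewrite [leLHS](_ : _ = 4 * M * r * (beta * (n%:R * v ^+ 2) + beta * P2)); last by ring.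
  rewrite [leRHS](_ : _ = 4 * M * r * ((B1 * n%:R + 1) * (v ^+ 2 + beta * P2))); last by ring.
  rewrite ler_wpM2l ?mulr_ge0//.
  have nv : 0 <= n%:R * v ^+ 2 by rewrite mulr_ge0 ?sqr_ge0.
  have B10 : 0 <= B1 by rewrite (le_trans _ dB).
  have h1 : beta * (n%:R * v ^+ 2) <= B1 * (n%:R * v ^+ 2) by rewrite ler_wpM2r.
  have h2 : 0 <= B1 * n%:R * (beta * P2) by rewrite !mulr_ge0// ltW.
  have h3 := sqr_ge0 v.
  lra.
have Kw : 0 <= 2 * (2 * r * (B1 * n%:R + 1)) * M * w ^+ 2.
  have B10 : 0 <= B1 by rewrite (le_trans _ dB).
  apply: mulr_ge0 (sqr_ge0 w); apply: mulr_ge0 => //.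
  by rewrite !mulr_ge0// addr_ge0// mulr_ge0.
have wv : 2 * w * v <= w ^+ 2 + v ^+ 2.
  have := sqr_ge0 (w - v); rewrite sqrrB; lra.
have low : M ^+ 2 * (2 * w * v + 2 * (v * (vt - beta * \sum_l pp l)) + dbeta * P2) <=
   M ^+ 2 * (w ^+ 2 + v ^+ 2 + 2 * (C * e1) + B1 / b0 * (beta * P2)).
  rewrite ler_wpM2l ?sqr_ge0//; apply: lerD => //; apply: lerD => //.
  by rewrite ler_pM2l.
set S1 := \sum_l 2 * p l * pt l in low *.
set S2 := \sum_l pp l in vN low *.
lra.
Qed.

(** The functions [wt], [wtt], [wx], [wxt], [wxx] stand for the derivatives of
    [w], with [wxx i l] the second derivative in the direction [l] only; [beta]
    stands for b^2.  They are separate data because the differential relations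
    are required for 0 < t < T only, while continuity is required on the whole
    space, where it can be combined with compactness. *)
Section energy.
Context {R : realType} {n m : nat} (T : R) (beta dbeta : R -> R)
  (w wt wtt : 'I_m -> R -> 'rV[R]_n -> R)
  (wx wxt wxx : 'I_m -> 'I_n -> R -> 'rV[R]_n -> R) (b0 B1 : R).
Context (T0 : 0 < T)
  (cbeta : continuous beta)
  (Dbeta : forall t, 0 < t < T -> is_derive t 1 beta (dbeta t))
  (b00 : 0 < b0)
  (bb : forall t, 0 <= t <= T -> b0 <= beta t <= B1)
  (dbB : forall t, 0 <= t <= T -> `|dbeta t| <= B1).
Context (cw : forall i, jointly_continuous (w i))
  (cwt : forall i, jointly_continuous (wt i))
  (cwx : forall i l, jointly_continuous (wx i l))
  (cwxt : forall i l, jointly_continuous (wxt i l))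
  (cwxx : forall i l, jointly_continuous (wxx i l)).
Context
  (Dw : forall i t x, 0 < t < T -> is_derive t 1 (w i ^~ x) (wt i t x))
  (Dwt : forall i t x, 0 < t < T -> is_derive t 1 (wt i ^~ x) (wtt i t x))
  (Dwx : forall i l t x, 0 < t < T -> is_derive t 1 (wx i l ^~ x) (wxt i l t x))
  (Dxwt : forall i l t x, 0 < t < T ->
     is_derive x (delta_mx 0 l) (wt i t) (wxt i l t x))
  (Dxwx : forall i l t x, 0 < t < T ->
     is_derive x (delta_mx 0 l) (wx i l t) (wxx i l t x)).

Definition energy_density (t : R) (x : 'rV[R]_n) : R :=
  \sum_i (w i t x ^+ 2 + wt i t x ^+ 2 + beta t * \sum_l wx i l t x ^+ 2).

Definition energy_density_dt (t : R) (x : 'rV[R]_n) : R :=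
  \sum_i (2 * w i t x * wt i t x + 2 * wt i t x * wtt i t x
    + dbeta t * (\sum_l wx i l t x ^+ 2)
    + beta t * \sum_l 2 * wx i l t x * wxt i l t x).

Definition energy_flux (r K : R) (l : 'I_n) (t : R) (x : 'rV[R]_n) : R :=
  \sum_i 2 * beta t * (cutoff r K t x * (wt i t x * wx i l t x)).

Definition energy_flux_dx (r K : R) (l : 'I_n) (t : R) (x : 'rV[R]_n) : R :=
  \sum_i 2 * beta t * (- (4 * tent r K t x * x 0 l) * (wt i t x * wx i l t x)
     + cutoff r K t x * (wxt i l t x * wx i l t x + wt i t x * wxx i l t x)).

Lemma energy_density_continuous : jointly_continuous energy_density.
Proof.
apply: jointly_continuous_sum => i; apply: jointly_continuousD.
  by apply: jointly_continuousD; apply: jointly_continuous_sqr.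
apply: jointly_continuousM; first exact: jointly_continuous_time.
by apply: jointly_continuous_sum => l; exact: jointly_continuous_sqr.
Qed.

Lemma energy_flux_dx_continuous (r K : R) l :
  jointly_continuous (energy_flux_dx r K l).
Proof.
have cc (c : R) : jointly_continuous (fun (t : R) (x : 'rV[R]_n) => c).
  by move=> p; exact: cvg_cst.
have cb : jointly_continuous (@tent R n r K) by exact: tent_continuous.
have cl := @jointly_continuous_coord R n l.
have cbt := @jointly_continuous_time R n _ cbeta.
apply: jointly_continuous_sum => i; apply: jointly_continuousM.
  exact: jointly_continuousM.
apply: jointly_continuousD.
  apply: jointly_continuousM; last exact: jointly_continuousM.
  have := jointly_continuousM (cc (-1)) (jointly_continuousM (jointly_continuousM (cc 4) cb) cl).
  by congr jointly_continuous; apply/funext => t; apply/funext => x; rewrite mulN1r.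
apply: jointly_continuousM; first exact: jointly_continuous_sqr.
by apply: jointly_continuousD; exact: jointly_continuousM.
Qed.

Lemma is_derive_energy_density t x : 0 < t < T ->
  is_derive t 1 (energy_density ^~ x) (energy_density_dt t x).
Proof.
move=> tT; apply: is_derive_bigsum => i.
have DS : is_derive t 1 (fun t => \sum_l wx i l t x ^+ 2)
   (\sum_l 2 * wx i l t x * wxt i l t x).
  by apply: is_derive_bigsum => l; apply: is_derive_sqr; exact: Dwx.
apply: (is_derive_eq (is_derive_add (is_derive_add (is_derive_sqr (Dw i x tT))
   (is_derive_sqr (Dwt i x tT))) (is_derive_mul (Dbeta tT) DS))).
by rewrite !addrA.
Qed.

Lemma is_derive_energy_flux (r K : R) l t x : 0 < t < T ->
  is_derive x (delta_mx 0 l) (energy_flux r K l t) (energy_flux_dx r K l t x).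
Proof.
move=> tT; apply: is_derive_bigsum => i.
apply: (is_derive_eq (is_derive_mul (is_derive_cst (2 * beta t) x _)
  (is_derive_mul (@is_derive_cutoff_space R n r K t x l)
     (is_derive_mul (Dxwt i l x tT) (Dxwx i l x tT))))).
by rewrite mul0r add0r.
Qed.

Lemma energy_density_ge0 t x : 0 <= t <= T -> 0 <= energy_density t x.
Proof.
move=> tT; have /andP[b0b _] := bb tT.
apply: sumr_ge0 => i _; rewrite !addr_ge0 ?sqr_ge0// mulr_ge0//.
  by rewrite (le_trans _ b0b)// ltW.
by apply: sumr_ge0 => l _; exact: sqr_ge0.
Qed.

(** The hypothesis on the residual is stated for every common bound [q] of the
    first-order jet of [w]; here it is used with [q] the Euclidean norm of the
    jet, which turns the product of d_t w_i with the residual into a multiple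
    of the energy density. *)
Lemma weighted_energy_growth (r C : R) (t : R) (x : 'rV[R]_n) :
  let K := 2 * r * (B1 * n%:R + 1) in
  0 <= r -> 0 <= C -> 0 < t < T -> (forall l, `|x 0 l| <= r) ->
  (forall q, (forall j, [/\ `|w j t x| <= q, `|wt j t x| <= q &
                           forall l, `|wx j l t x| <= q]) ->
     forall i, `|wtt i t x - beta t * \sum_l wxx i l t x| <= C * q) ->
  - (2 * K * tent r K t x) * energy_density t x
  + cutoff r K t x * energy_density_dt t x <=
  \sum_l energy_flux_dx r K l t x
  + (1 + 2 * C * m%:R * (1 + b0^-1) + B1 / b0)
      * (cutoff r K t x * energy_density t x).
Proof.
move=> K r0 C0 t0T xr res.
have tT : 0 <= t <= T by case/andP: t0T => /ltW -> /ltW ->.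
have /andP[b0b bB] := bb tT.
have beta0 : 0 < beta t by exact: lt_le_trans b0b.
pose S := \sum_i (w i t x ^+ 2 + wt i t x ^+ 2 + \sum_l wx i l t x ^+ 2).
have wx0 i : 0 <= \sum_l wx i l t x ^+ 2 by apply: sumr_ge0 => l _; exact: sqr_ge0.
have S0 : 0 <= S by apply: sumr_ge0 => i _; rewrite !addr_ge0 ?sqr_ge0.
have leS j : w j t x ^+ 2 + wt j t x ^+ 2 + \sum_l wx j l t x ^+ 2 <= S.
  by rewrite /S (bigD1 j)//= lerDl sumr_ge0// => i _; rewrite !addr_ge0 ?sqr_ge0.
have sqS (a : R) : a ^+ 2 <= S -> `|a| <= Num.sqrt S.
  by move=> aS; rewrite -sqrtr_sqr ler_sqrt.
have wS j : [/\ `|w j t x| <= Num.sqrt S, `|wt j t x| <= Num.sqrt S &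
    forall l, `|wx j l t x| <= Num.sqrt S].
  have h1 := sqr_ge0 (w j t x); have h2 := sqr_ge0 (wt j t x).
  have h3 := wx0 j; have h4 := leS j.
  split; [by apply: sqS; lra|by apply: sqS; lra|move=> l; apply: sqS].
  apply: (@le_trans _ _ (\sum_l wx j l t x ^+ 2)); last by lra.
  by rewrite (bigD1 l)//= lerDl sumr_ge0// => i _; exact: sqr_ge0.
have vN i : wt i t x * (wtt i t x - beta t * \sum_l wxx i l t x) <= C * S.
  rewrite (le_trans (ler_norm _))// normrM -(sqr_sqrtr S0) expr2 mulrCA.
  by apply: ler_pM => //; [by have [] := wS i|exact: res].
have SE : S <= (1 + b0^-1) * energy_density t x.
  rewrite /S /energy_density mulr_sumr; apply: ler_sum => i _.
  have h1 := sqr_ge0 (w i t x); have h2 := sqr_ge0 (wt i t x).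
  have h3 : \sum_l wx i l t x ^+ 2 <= b0^-1 * (beta t * \sum_l wx i l t x ^+ 2).
    by rewrite mulrA ler_peMl// ler_pdivlMl// mulr1.
  have h4 : 0 <= beta t * \sum_l wx i l t x ^+ 2 by rewrite mulr_ge0// ltW.
  have b0i : 0 <= b0^-1 by rewrite invr_ge0 ltW.
  have h5 : 0 <= b0^-1 * (w i t x ^+ 2 + wt i t x ^+ 2).
    by rewrite mulr_ge0// addr_ge0.
  lra.
have := @ler_sum R _ (index_enum 'I_m) xpredT _ _ (fun i _ =>
  @energy_density_growth R n x r (tent r K t x) (w i t x) (wt i t x) (wtt i t x)
   (beta t) (dbeta t) b0 B1 C S (fun l => wx i l t x) (fun l => wxt i l t x)
   (fun l => wxx i l t x) r0 xr (tent_ge0 r K t x) b00 b0b bB (dbB tT) (vN i)).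
rewrite -/K big_split/= -!mulr_sumr -/(energy_density t x).
rewrite -/(energy_density_dt t x) -/(cutoff r K t x) => H.
apply: (le_trans H); rewrite big_split/= exchange_big/= lerD2l -mulr_sumr.
rewrite [leRHS]mulrCA ler_wpM2l ?sqr_ge0//.
rewrite !big_split/= sumr_const card_ord -mulr_sumr.
have E1 : energy_density t x = \sum_i w i t x ^+ 2 + \sum_i wt i t x ^+ 2
    + \sum_i beta t * \sum_l wx i l t x ^+ 2.
  by rewrite /energy_density !big_split.
have h1 : 0 <= \sum_i w i t x ^+ 2 by apply: sumr_ge0 => i _; exact: sqr_ge0.
have h2 : 0 <= \sum_i wt i t x ^+ 2 by apply: sumr_ge0 => i _; exact: sqr_ge0.
have h3 : 0 <= \sum_i beta t * \sum_l wx i l t x ^+ 2.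
  by apply: sumr_ge0 => i _; rewrite mulr_ge0// ltW.
have B10 : 0 <= B1 / b0.
  by apply: divr_ge0 (ltW b00); rewrite (le_trans _ bB)// ltW.
rewrite -mulr_natl.
have h4 : m%:R * (2 * (C * S)) <= m%:R * (2 * (C * ((1 + b0^-1) * energy_density t x))).
  by do 3 rewrite ler_wpM2l//.
have h5 : B1 / b0 * (\sum_i beta t * \sum_l wx i l t x ^+ 2) <= B1 / b0 * energy_density t x.
  by rewrite ler_wpM2l// E1; lra.
have h6 : \sum_i w i t x ^+ 2 + \sum_i wt i t x ^+ 2 <= energy_density t x.
  by rewrite E1; lra.
set W := \sum_i w i t x ^+ 2 in h6 *.
set V := \sum_i wt i t x ^+ 2 in h6 *.
set X := \sum_i beta t * _ in h5 *.
set e := energy_density t x in h4 h5 h6 *.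
lra.
Qed.

Lemma compact_cylinder (r : R) :
  compact [set p : R * 'rV[R]_n | 0 <= p.1 <= T /\ forall l, `|p.2 0 l| <= r].
Proof.
have -> : [set p : R * 'rV[R]_n | 0 <= p.1 <= T /\ forall l, `|p.2 0 l| <= r] =
    `[0, T] `*` [set x : 'rV[R]_n | forall l, `[- r, r]%classic (x ord0 l)].
  apply/seteqP; split=> -[t x] /=; rewrite in_itv/= => -[-> H]; split=> // l.
    by rewrite in_itv/= -ler_norml; exact: H.
  by have := H l; rewrite in_itv/= -ler_norml.
apply: compact_setX; first exact: segment_compact.
by apply: (@rV_compact _ _ (fun=> `[- r, r]%classic)) => _; exact: segment_compact.
Qed.

(** The radius [r] is chosen so that the cutoff is still positive at the point
    [(T, 0)].  If [w i T 0] were nonzero, the weighted energy density would be at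
    least [delta] on a cube around the origin; the resulting lower bound for
    the grid sum contradicts Gronwall's upper bound when the tolerance [eps] on
    the divergence is small. *)
Theorem energy_uniqueness :
  (forall r, 0 < r -> exists2 C, 0 <= C & forall t (x : 'rV[R]_n), 0 < t < T ->
     (forall l, `|x 0 l| <= r) ->
     forall q, (forall j, [/\ `|w j t x| <= q, `|wt j t x| <= q &
                              forall l, `|wx j l t x| <= q]) ->
     forall i, `|wtt i t x - beta t * \sum_l wxx i l t x| <= C * q) ->
  (forall i x, [/\ w i 0 x = 0, wt i 0 x = 0 & forall l, wx i l 0 x = 0]) ->
  forall i, w i T 0 = 0.
Proof.
move=> res init i0; apply/eqP/negP => /negP w0.
have T0T : 0 <= T <= T by rewrite lexx ltW.
have B10 : 0 <= B1.
  by have /andP[h1 h2] := bb T0T; rewrite (le_trans _ h2)// (le_trans _ h1)// ltW.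
(* The speed of the cutoff is K = kappa r, so that the tent at (T, 0) has the
   height r^2 - K T = r (r - kappa T) = r. *)
pose kappa := 2 * (B1 * n%:R + 1).
have kappa0 : 0 < kappa by rewrite mulr_gt0// ltr_wpDl// mulr_ge0.
pose r := kappa * T + 1; pose K := 2 * r * (B1 * n%:R + 1).
have r0 : 0 < r by rewrite ltr_wpDl// mulr_ge0// ltW.
have K0 : 0 < K by rewrite !mulr_gt0// ltr_wpDl// mulr_ge0.
have [C C0 resC] := res r r0.
pose C' := 1 + 2 * C * m%:R * (1 + b0^-1) + B1 / b0.
have b0i : 0 <= b0^-1 by rewrite invr_ge0 ltW.
have C'0 : 0 <= C' by rewrite !addr_ge0// !mulr_ge0// addr_ge0.
pose phi (t : R) (x : 'rV[R]_n) := cutoff r K t x * energy_density t x.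
have cphi : jointly_continuous phi.
  by apply: jointly_continuousM; [exact: cutoff_continuous|exact: energy_density_continuous].
have phi0 t x : 0 <= t <= T -> 0 <= phi t x.
  by move=> tT; rewrite mulr_ge0 ?sqr_ge0// energy_density_ge0.
have phiT0 : 0 < phi T 0.
  rewrite mulr_gt0//.
    rewrite exprn_gt0// lt_max; apply/orP; right.
    rewrite big1 ?subr0; last by move=> l _; rewrite mxE expr0n.
    rewrite /K (_ : _ - _ = r * (r - kappa * T)); last by rewrite /kappa; ring.
    by rewrite /r addrAC subrr add0r mulr1.
  have w2 : 0 < w i0 T 0 ^+ 2 by rewrite lt_neqAle sqr_ge0 eq_sym sqrf_eq0 w0.
  rewrite (lt_le_trans w2)// /energy_density (bigD1 i0)//=.
  have /andP[bT _] := bb T0T.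
  have bT0 : 0 <= beta T by rewrite (le_trans _ bT)// ltW.
  have pos i : 0 <= beta T * \sum_l wx i l T 0 ^+ 2.
    by rewrite mulr_ge0// sumr_ge0// => l _; exact: sqr_ge0.
  rewrite -!addrA lerDl !addr_ge0 ?sqr_ge0// sumr_ge0// => i _.
  by rewrite !addr_ge0 ?sqr_ge0.
pose delta := phi T 0 / 2.
have delta0 : 0 < delta by rewrite divr_gt0.
have [rho rho0 phi_rho] : exists2 rho, 0 < rho &
    forall x, `|x| < rho -> delta <= phi T x.
  have /cvgrPdist_lt/(_ _ delta0)/nbhs_ballP[rho rho0 H] :=
    @jointly_continuous_space R n phi T cphi 0.
  exists rho => // x xr; have := H x; rewrite -ball_normE/= sub0r normrN => /(_ xr).
  by rewrite ltr_norml => /andP[_]; rewrite /delta; lra.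
(* The cube [0, r / M]^n lies in the ball where phi T >= delta. *)
have [M M0 rM] : exists2 M : nat, (0 < M)%N & r / M%:R < rho.
  have q0 : 0 <= r / rho by rewrite divr_ge0// ltW.
  have qb := archi_boundP q0; exists (Num.bound (r / rho)).
    by rewrite -(ltr0n R) (le_lt_trans q0).
  by rewrite ltr_pdivrMr ?(le_lt_trans q0)// mulrC -ltr_pdivrMr.
(* Divided by J^n, Gronwall's bound for the grid sum at time T is Z eps; it is
   smaller than delta for this choice of eps. *)
pose Z := ((2 * M) ^ n * n)%:R * T * expR (C' * T).
have Z0 : 0 <= Z by rewrite !mulr_ge0 ?expR_ge0// ltW.
have Z1 : 0 < Z + 1 by rewrite ltr_wpDl.
pose eps := delta / (Z + 1).
have eps0 : 0 < eps by rewrite divr_gt0.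
pose small l (s : R) := forall p : R * 'rV[R]_n,
    0 <= p.1 <= T /\ (forall i, `|p.2 0 i| <= r) ->
    `|energy_flux_dx r K l p.1 (p.2 + s *: delta_mx 0 l)
      - energy_flux_dx r K l p.1 p.2| <= eps.
have small_near l : \forall s \near (0 : R), small l s.
  exact: (@uniform_oscillation R n (fun p => energy_flux_dx r K l p.1 p.2) _
    (delta_mx 0 l) eps (@compact_cylinder r) (@energy_flux_dx_continuous r K l) eps0).
have /nbhs_ballP[eta /= eta0 osc] : \forall s \near (0 : R), forall l, small l s.
  exact: filter_forall small_near.
have [J J0 meshJ] : exists2 J : nat, (0 < J)%N & mesh (2 * M * J) r < eta.
  have M0' : 0 < M%:R :> R by rewrite ltr0n.
  have q0 : 0 <= r / (M%:R * eta) by rewrite divr_ge0 ?mulr_ge0// ltW.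
  have qb := archi_boundP q0; exists (Num.bound (r / (M%:R * eta))).
    by rewrite -(ltr0n R) (le_lt_trans q0).
  set J := Num.bound _ in qb *.
  have J0 : 0 < J%:R :> R by rewrite (le_lt_trans q0).
  rewrite /mesh (_ : _ / _ = r / (M%:R * J%:R)); last first.
    by rewrite !natrM; field; rewrite !gt_eqF.
  by move: qb; rewrite !ltr_pdivrMr ?mulr_gt0// => qb; lra.
pose N := (2 * M * J)%N.
have N0 : (0 < N)%N by rewrite !muln_gt0 M0 J0.
pose pt := @grid_point R n N r.
pose S t := \sum_(k : {ffun 'I_n -> 'I_N}) phi t (pt k).
pose dS t := \sum_(k : {ffun 'I_n -> 'I_N})
  (- (2 * K * tent r K t (pt k)) * energy_density t (pt k)
   + cutoff r K t (pt k) * energy_density_dt t (pt k)).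
have cS : continuous S.
  by apply: continuous_bigsum => k; exact: jointly_continuous_slice.
have DS t : 0 < t < T -> is_derive t 1 S (dS t).
  move=> tT; apply: is_derive_bigsum => k.
  exact: (is_derive_mul (@is_derive_cutoff_time R n r K t (pt k))
                      (is_derive_energy_density (pt k) tT)).
have dSle t : 0 < t < T ->
    dS t <= C' * S t + (#|{ffun 'I_n -> 'I_N}| * n)%:R * eps.
  move=> tT; have tT' : 0 <= t <= T by case/andP: tT => /ltW -> /ltW ->.
  rewrite addrC.
  apply: (@le_trans _ _ (\sum_(k : {ffun 'I_n -> 'I_N})
      (\sum_l energy_flux_dx r K l t (pt k) + C' * phi t (pt k)))).
    apply: ler_sum => k _; apply: weighted_energy_growth => //; first exact: ltW.
      by move=> l; exact/grid_point_bound/ltW.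
    by apply: resC => // l; exact/grid_point_bound/ltW.
  rewrite big_split/= -mulr_sumr lerD2r.
  apply: (@grid_divergence R n N r (fun l => energy_flux r K l t)
    (fun l => energy_flux_dx r K l t) eps N0 r0).
  - by move=> l x; exact: is_derive_energy_flux.
  - move=> l x xr; rewrite /energy_flux big1// => i _.
    have -> : cutoff r K t x = 0.
      apply: (@cutoff_boundary R n r K t x l); last by rewrite xr gtr0_norm.
      by apply: mulr_ge0; [exact: ltW|case/andP: tT => /ltW].
    by rewrite mul0r mulr0.
  - move=> l x s xr /andP[s0 sm]; apply: (osc s _ l (t, x)) => //.
    by rewrite -ball_normE/= sub0r normrN ger0_norm// (le_lt_trans sm).
have S0 : S 0 <= 0.
  rewrite /S big1// => k _; rewrite /phi /energy_density big1 ?mulr0// => i _.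
  have [-> -> wx0] := init i (pt k); rewrite expr0n/= !add0r big1 ?mulr0//.
  by move=> l _; rewrite wx0 expr0n.
have up := gronwall_affine T0 C'0 (mulr_ge0 (ler0n R _) (ltW eps0)) cS DS dSle S0.
have low : (J ^ n)%:R * delta <= S T.
  apply: grid_mass => //; first by move=> x; exact: phi0.
  by move=> x xM; apply: phi_rho; exact: le_lt_trans rM.
have J0' : 0 < (J ^ n)%:R :> R by rewrite ltr0n expn_gt0 J0.
have : (J ^ n)%:R * delta <= (J ^ n)%:R * (Z * eps).
  rewrite (le_trans low)// (le_trans up)// card_ffun !card_ord /N /Z expnMn.
  by rewrite !natrM le_eqVlt; apply/orP; left; apply/eqP; ring.
rewrite ler_pM2l// /eps mulrA ler_pdivlMr// mulrDr mulr1 mulrC.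
by rewrite gerDl leNgt delta0.
Qed.

End energy.

(** * Derivatives of functions of class C^2 on the half space *)

(** At positive times the one-sided derivative is the two-sided one. *)
Lemma dt_dom_pos (R : realType) (t : R) : 0 < t -> dt_dom t = (0 : R)^'.
Proof.
move=> t0; have near_dom : \forall s \near (0 : R)^', 0 <= t + s.
  near=> s; have : `|s| <= t by near: s; exact: dnbhs0_le.
  by rewrite ler_norml => /andP[+ _]; rewrite lerNl -subr_ge0 opprK.
apply/seteqP; split=> P; rewrite /dt_dom /within /=.
  by apply: filterS2 near_dom => s s0; apply.
by apply: filterS => s.
Unshelve. all: by end_near. Qed.

Lemma is_derive_dt (R : realType) (n : nat) (c : R -> 'rV[R]_n -> R) (t : R) x :
  0 < t -> dt_exists c t x -> is_derive t 1 (c ^~ x) (dt c t x).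
Proof.
rewrite /dt_exists /dt => /dt_dom_pos ->.
have -> : dt_quotient c t x =
    (fun h : R => h^-1 *: (c (h *: 1 + t) x - c t x)).
  by apply/funext => s; rewrite /dt_quotient [s *: 1]mulr1 [s + t]addrC.
by move=> ce; apply: DeriveDef.
Qed.

Lemma is_derive_dx (R : realType) (n : nat) (l : 'I_n) (c : R -> 'rV[R]_n -> R)
    (t : R) x :
  derivable (c t) x (delta_mx 0 l) -> is_derive x (delta_mx 0 l) (c t) (dx l c t x).
Proof. exact: derivableP. Qed.

(** Freezing the time at 0 for negative times turns continuity up to the
    boundary into continuity on the whole space. *)
Lemma within_jointly_continuous (R : realType) (n : nat)
    (c : R -> 'rV[R]_n -> R) :
  {within [set p : R * 'rV[R]_n | 0 <= p.1],
     continuous (fun p : R * 'rV[R]_n => c p.1 p.2)} ->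
  jointly_continuous (fun t x => c (Num.max 0 t) x).
Proof.
move=> /subspace_continuousP cc p.
pose cl (p : R * 'rV[R]_n) := (Num.max 0 p.1, p.2).
have clp : cl q @[q --> p] --> cl p.
  apply: cvg_to_pair; last by case: (p) => ? ?; exact: cvg_snd.
  apply: (@continuous_comp _ _ _ fst (fun t : R => Num.max 0 t)).
    by case: (p) => ? ?; exact: cvg_fst.
  by apply: continuous_max; [exact: cvg_cst|exact: cvg_id].
have Dcl q : [set p : R * 'rV[R]_n | 0 <= p.1] (cl q) by rewrite /= le_max lexx.
have H := cc (cl p) (Dcl p).
apply: (@cvg_comp _ _ _ cl (fun p => c p.1 p.2) _
  (within [set p : R * 'rV[R]_n | 0 <= p.1] (nbhs (cl p)))) => //.
move=> A /= wA; have := clp _ wA; rewrite /= /nbhs/=.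
apply: filterS => q; apply; exact: Dcl.
Qed.

Lemma mixed_derivatives_agree (R : realType) (n : nat) (c : R -> 'rV[R]_n -> R)
    (l : 'I_n) (t : R) (x : 'rV[R]_n) :
  Ck_spacetime 2 c -> 0 < t -> dt (dx l c) t x = dx l (dt c) t x.
Proof.
move=> [_ [[ec [_ [[_ _] dtc]]] dc]] t0.
have [exc [_ [[edxc [cdtdx _]] _]]] := dc l.
have [exdt [cdxdt _]] := dtc l.
have jc1 := within_jointly_continuous cdxdt.
have jc2 := within_jointly_continuous cdtdx.
have cs (g : R -> 'rV[R]_n -> R) : jointly_continuous g ->
   continuous (fun p : R * R => g p.1 (x + p.2 *: delta_mx 0 l)).
  move=> cg p; apply: (@continuous_comp _ _ _
    (fun p : R * R => (p.1, x + p.2 *: delta_mx 0 l)) (fun q => g q.1 q.2)); last exact: cg.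
  apply: cvg_to_pair; first by case: (p) => ? ?; exact: cvg_fst.
  apply: cvgD; first exact: cvg_cst.
  by apply: cvgZ; [case: (p) => ? ?; exact: cvg_snd|exact: cvg_cst].
pose y s : 'rV[R]_n := x + s *: delta_mx 0 l.
have D t' s' : t <= t' <= t + 1 -> 0 <= s' <= 0 + 1 ->
    [/\ is_derive t' 1 (fun r => c r (y s')) (dt c t' (y s')),
        is_derive s' 1 (fun r => dt c t' (y r)) (dx l (dt c) (Num.max 0 t') (y s')),
        is_derive s' 1 (fun r => c t' (y r)) (dx l c t' (y s')) &
        is_derive t' 1 (fun r => dx l c r (y s')) (dt (dx l c) (Num.max 0 t') (y s'))].
  move=> /andP[tt' _] _; have t'0 : 0 < t' by exact: lt_le_trans tt'.
  rewrite (max_r (ltW t'0)); split.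
  - exact: is_derive_dt (ec _ _ (ltW t'0)).
  - have /is_derive_lineP := is_derive_dx (exdt t' (y s') (ltW t'0)); exact.
  - have /is_derive_lineP := is_derive_dx (exc t' (y s') (ltW t'0)); exact.
  - exact: is_derive_dt (edxc _ _ (ltW t'0)).
have := @schwarz_mixed R (fun t s => c t (y s)) (fun t s => dt c t (y s))
  (fun t s => dx l c t (y s))
  (fun t s => dx l (dt c) (Num.max 0 t) (y s))
  (fun t s => dt (dx l c) (Num.max 0 t) (y s)) t 0 1 ltr01 D
  (cs _ jc1 (t, 0)) (cs _ jc2 (t, 0)).
have y0 : y 0 = x by rewrite /y scale0r addr0.
have mt : Num.max 0 t = t by apply: max_r; exact: ltW.
by cbv beta; rewrite mt y0 => <-.
Qed.

(** * Integration of the equation for constant maps *)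

Lemma is_derive_int0 (R : realType) (f : R -> R) (x : R) :
  continuous f -> is_derive x 1 (int0 f) (f x).
Proof.
(* Near [x], [int0 f] is the integral from [a] minus a constant; starting to
   the left of both [x] and 0 makes the two cases of [int0] agree. *)
move=> cf; pose a := Num.min x 0 - 1.
have ax : a < x by rewrite ltrBlDr gt_min ltrDl ltr01.
have a0 : a < 0 by rewrite ltrBlDr gt_min ltrDl ltr01 orbT.
have intf (u v : R) : lebesgue_measure.-integrable `[u, v] (EFin \o f).
  by apply: continuous_compact_integrable; [exact: segment_compact|exact: continuous_subspaceT].
pose P y := (\int[lebesgue_measure]_(r in `[a, y]) f r)%R.
have splitI (u v : R) : a <= u -> u <= v ->
    (\int[lebesgue_measure]_(r in `[u, v]) f r = P v - P u)%R.
  move=> au uv; rewrite /P Rintegral_itvB ?bnd_simp//.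
  rewrite Rintegral_itv_obnd_cbnd//.
  by apply: integrableS (intf u v) => //; apply: subset_itvr; rewrite bnd_simp.
have [dP P'] : derivable P x 1 /\ (P^`())%classic x = f x.
  by apply: (@continuous_FTC1_closed R f a x (x + 1)) => //; [rewrite ltrDl|exact: cf].
have DP : is_derive x 1 (fun y => P y - P 0) (f x).
  have h : is_derive x 1 P (f x) 
    by apply: DeriveDef; [exact: dP|rewrite -derive1E].
  by apply: (is_derive_eq (is_deriveB h (is_derive_cst (P 0) x 1))); rewrite subr0.
apply: near_eq_is_derive DP; near=> y.
have ay : a < y by near: y; exact: lt_nbhsr.
rewrite /int0; case: ifPn => [y0|]; first by rewrite splitI// ltW.
by rewrite -ltNge => y0; rewrite splitI ?ltW// opprB.
Unshelve. all: by end_near. Qed.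

Lemma int0_0 (R : realType) (f : R -> R) : int0 f 0 = 0.
Proof. by rewrite /int0 lexx set_itv1 Rintegral_set1. Qed.

Lemma int0_continuous (R : realType) (f : R -> R) : continuous f -> continuous (int0 f).
Proof. by move=> cf x; exact: is_derive_continuous (is_derive_int0 x cf). Qed.

Lemma int0_increasing (R : realType) (g : R -> R) (x y : R) :
  continuous g -> (forall t, 0 < g t) -> x < y -> int0 g x < int0 g y.
Proof.
move=> cg g0 xy.
have [t _ E] := MVT_everywhere (ltW xy) (fun t _ => is_derive_int0 t cg).
by rewrite -subr_gt0 E mulr_gt0 ?subr_gt0.
Qed.

Lemma int0_inj (R : realType) (g : R -> R) :
  continuous g -> (forall t, 0 < g t) -> injective (int0 g).
Proof.
move=> cg g0 x y E; have [xy|yx|//] := ltgtP x y.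
  by have := int0_increasing cg g0 xy; rewrite E ltxx.
by have := int0_increasing cg g0 yx; rewrite E ltxx.
Qed.

(** Both sides vanish at 0 and have the same derivative. *)
Lemma int0_reflect (R : realType) (f : R -> R) (s : R) :
  continuous f -> int0 (fun t => - f (- t)) s = int0 f (- s).
Proof.
move=> cf.
have cN : continuous (fun t => - f (- t)).
  move=> t; apply: cvgN; apply: (@continuous_comp _ _ _ -%R f); last exact: cf.
  by apply: cvgN; exact: cvg_id.
pose d t := int0 (fun t => - f (- t)) t - int0 f (- t).
suff Dd (t : R) : is_derive t 1 d 0.
  have := is_derive_0_is_cst s 0 Dd; rewrite /d oppr0 !int0_0 subrr.
  by move/eqP; rewrite subr_eq0 => /eqP.
apply: (is_derive_eq (is_deriveB (is_derive_int0 t cN)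
  (is_derive_comp1 (is_derive_int0 (- t) cf) (is_deriveNid t 1)))).
by ring.
Qed.

Lemma int0_bounded (R : realType) (g : R -> R) :
  continuous g -> (forall t, 0 < g t) ->
  (\int[lebesgue_measure]_(s in `[0%R, +oo[) (g s)%:E != +oo)%E ->
  exists A, forall s, 0 <= s -> int0 g s <= A.
Proof.
move=> cg g0 fin.
set I := integral _ _ _ in fin.
have If : I \is a fin_num.
  rewrite ge0_fin_numE; first by rewrite lt_neqAle fin leey.
  by apply: integral_ge0 => s _; rewrite lee_fin ltW.
exists (fine I) => s s0; rewrite /int0 s0 /Rintegral.
have le : (\int[lebesgue_measure]_(r in `[0%R, s]) (g r)%:E <= I)%E.
  apply: ge0_subset_integral => //.
    apply/measurable_EFinP; apply: measurable_funTS.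
    exact: continuous_measurable_fun.
    by move=> r _; rewrite lee_fin ltW.
  by move=> r /=; rewrite !in_itv/= => /andP[-> _].
apply: fine_le => //.
rewrite ge0_fin_numE.
  rewrite (le_lt_trans le)// -ge0_fin_numE// integral_ge0// => r _.
  by rewrite lee_fin ltW.
by apply: integral_ge0 => r _; rewrite lee_fin ltW.
Qed.

(** With G(s) = int_0^s e^F bounded on [0, oo) and A its supremum there, phi is
    the inverse of G applied to c int_0^t b^n, where c makes this integral equal
    to A at t = 1.  Thus phi' = psi = c b^n e^{- F(phi)}, and the equation for
    psi' is the logarithmic derivative of this formula. *)
Lemma blowup_profile (R : realType) (n : nat) (b db f : R -> R) :
  continuous f -> (forall t : R, is_derive t 1 b (db t)) -> (forall t, 0 < b t) ->
  (\int[lebesgue_measure]_(s in `[0%R, +oo[) (expR (int0 f s))%:E != +oo)%E ->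
  exists phi psi : R -> R,
  [/\ phi 0 = 0,
      forall t : R, 0 <= t < 1 -> is_derive t 1 phi (psi t),
      forall t : R, 0 <= t < 1 ->
        is_derive t 1 psi (n%:R * (db t / b t) * psi t - f (phi t) * psi t ^+ 2) &
      forall S, \forall t \near (1 : R), t < 1 -> S < phi t].
Proof.
move=> cf Db b0 fin.
have cF : continuous (fun s => expR (int0 f s)).
  move=> s; apply: (@continuous_comp _ _ _ (int0 f) expR); first exact: int0_continuous.
  exact: continuous_expR.
have F0 s : 0 < expR (int0 f s) by exact: expR_gt0.
have [ub Gub] := int0_bounded cF F0 fin.
set G := int0 (fun s => expR (int0 f s)) in Gub.
pose A := sup [set G s | s in [set s | 0 <= s]].
have supG : has_sup [set G s | s in [set s | 0 <= s]].
  split; first by exists (G 0), 0 => //=.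
  by exists ub => _ [s /= s0 <-]; exact: Gub.
have GA s : 0 <= s -> G s < A.
  move=> s0; apply: (@lt_le_trans _ _ (G (s + 1))).
    by apply: int0_increasing => //; rewrite ltrDl.
  by apply: ub_le_sup; [exact: supG.2|exists (s + 1) => //=; rewrite addr_ge0].
have A0 : 0 < A by rewrite -(int0_0 (fun s => expR (int0 f s))); exact: GA.
have cb : continuous b by move=> t; exact: is_derive_continuous (Db t).
have cbn : continuous (fun t => b t ^+ n).
  move=> t; apply: (@continuous_comp _ _ _ b (fun y => y ^+ n)); first exact: cb.
  exact: exprn_continuous.
have bn0 t : 0 < b t ^+ n by exact: exprn_gt0.
set B := int0 (fun t => b t ^+ n).
have B0 : B 0 = 0 by exact: int0_0.
have Binc x y : x < y -> B x < B y by exact: int0_increasing.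
have B1 : 0 < B 1 by rewrite -B0; exact: Binc.
pose c := A / B 1; have c0 : 0 < c by rewrite divr_gt0.
pose g y : R := xget 0 [set s | G s = y].
have gK s : g (G s) = s.
  rewrite /g; case: xgetP => [y _ /= /(int0_inj cF F0)//|].
  by move=> /(_ s)/(_ erefl).
pose phi t := g (c * B t).
pose psi t := c * b t ^+ n * expR (- int0 f (phi t)).
(* For t < 1 the number c * B t is below the supremum A, hence a value of G. *)
have Gphi t : 0 <= t < 1 -> G (phi t) = c * B t /\ 0 <= phi t.
  move=> /andP[t0 t1].
  have cBt0 : 0 <= c * B t.
    rewrite mulr_ge0 ?(ltW c0)//; move: t0; rewrite le_eqVlt => /predU1P[<-|t0].
      by rewrite B0.
    by rewrite -B0 ltW// Binc.
  have cBA : c * B t < A by rewrite /c mulrAC -mulrA gtr_pMr// ltr_pdivrMr// mul1r Binc.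
  have [_ [s1 /= s10 <-] cBs] : exists2 y, [set G s | s in [set s | 0 <= s]] y & c * B t < y.
    exact: (@sup_gt _ _ (c * B t) supG.1).
  have [||s] := @IVT R G 0 s1 (c * B t) s10.
  - by apply: continuous_subspaceT; exact: int0_continuous.
  - by rewrite ge_min le_max {1}/G int0_0 cBt0 (ltW cBs) orbT.
  rewrite in_itv/= => /andP[s0 _] E; rewrite /phi -E gK; split => //.
exists phi, psi.
have Dphi (t : R) : 0 <= t < 1 -> is_derive t 1 phi (psi t).
  move=> ti; have [GE _] := Gphi t ti.
  have Dg : is_derive (G (phi t)) 1 g (expR (int0 f (phi t)))^-1.
    apply: (@is_derive_inverse R G g); last by rewrite gt_eqF.
    - by near=> s; exact: gK.
    - by near=> s; exact: int0_continuous.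
    - exact: is_derive_int0.
  rewrite GE in Dg.
  have DcB : is_derive t 1 (fun t => c * B t) (c * b t ^+ n).
    by apply: (is_derive_eq (is_derive_mul (is_derive_cst c t 1) (is_derive_int0 t cbn)));
      rewrite mul0r add0r.
  have -> : psi t = (expR (int0 f (phi t)))^-1 * (c * b t ^+ n) by rewrite /psi expRN mulrC.
  exact: (@is_derive_comp1 R _ g (fun t => c * B t) t 1 _ _ Dg DcB).
split=> //.
- have -> : phi 0 = g (G 0) by rewrite /phi B0 mulr0 /G int0_0.
  exact: gK.
- move=> t ti; have Dp := Dphi t ti.
  have De : is_derive t 1 (fun t => expR (- int0 f (phi t)))
      (expR (- int0 f (phi t)) * - (f (phi t) * psi t)).
    apply: (@is_derive_comp1 _ _ expR (fun t => - int0 f (phi t))).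
    by apply: is_deriveN; exact: (is_derive_comp1 (is_derive_int0 (phi t) cf) Dp).
  have Dbn : is_derive t 1 (fun t => b t ^+ n) (n%:R * (db t / b t) * b t ^+ n).
    have h : is_derive t 1 b (db t) by [].
    have hn := is_deriveX n h; rewrite exprfctE in hn; apply: (is_derive_eq hn).
    rewrite /GRing.scale/=; case: (n) => [|k]; first by rewrite !mul0r.
    by rewrite /= exprS; field; rewrite gt_eqF.
  apply: (is_derive_eq (is_derive_mul (is_derive_mul (is_derive_cst c t 1) Dbn) De)).
  by rewrite /psi /=; ring.
- move=> S; pose S' := Num.max S 0.
  have S'0 : 0 <= S' by rewrite le_max lexx orbT.
  have cBc : {for (1 : R), continuous (fun t => c * B t)}.
    by apply: cvgM; [exact: cvg_cst|exact: int0_continuous].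
  have cB1 : c * B 1 = A by rewrite /c divfK// gt_eqF.
  have near1 : \forall t \near (1 : R), G S' < c * B t.
    have d0 : 0 < A - G S' by rewrite subr_gt0 GA.
    move/cvgrPdist_lt: cBc => /(_ _ d0); apply: filterS => t.
    by rewrite cB1 ltr_norml => /andP[_]; lra.
  near=> t => t1.
  have t0 : 0 <= t by rewrite ltW//; near: t; exact: lt_nbhsr.
  have [GE p0] := Gphi t (introT andP (conj t0 t1)).
  have SS : S <= S' by rewrite le_max lexx.
  apply: (le_lt_trans SS); rewrite ltNge; apply/negP => pS.
  have : G (phi t) <= G S'.
    move: pS; rewrite le_eqVlt => /predU1P[->//|pS]; exact/ltW/int0_increasing.
  by rewrite GE leNgt; apply/negP; rewrite negbK; near: t.
Unshelve. all: by end_near. Qed.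

(** * Comparison with the constant solution *)

Lemma exists_nonzero_coord (R : realType) (m : nat) (a : 'rV[R]_m) :
  a != 0 -> exists i, a 0 i != 0.
Proof.
move=> a0; apply/existsP; apply: contraNT a0; rewrite negb_exists => /forallP H.
by apply/eqP/rowP => i; have := H i; rewrite negbK mxE => /eqP.
Qed.

Lemma self_coherent_continuous (R : realType) (m : nat) (Omega : set 'rV[R]_m)
    (h : 'rV[R]_m -> 'M[R]_m) (a : 'rV[R]_m) (f : R -> R) :
  riemannian_chart Omega h -> self_coherent Omega h a f -> continuous f.
Proof.
move=> ch [a0 Oa eqf].
have [i ai] := exists_nonzero_coord a0.
have -> : f = (fun t => (a 0 i)^-1 *
    \sum_(j < m) \sum_(k < m) christoffel h i j k (t *: a) * a 0 j * a 0 k).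
  by apply/funext => t; rewrite eqf mulKf.
move=> t; apply: cvgM; first exact: cvg_cst.
move: t; apply: continuous_bigsum => j; apply: continuous_bigsum => k t.
apply: cvgM; last exact: cvg_cst.
apply: cvgM; last exact: cvg_cst.
apply: (@continuous_comp _ _ _ (fun t : R => t *: a) (christoffel h i j k)).
  by apply: cvgZ; [exact: cvg_id|exact: cvg_cst].
by apply: locally_lipschitz_continuous; exact: christoffel_locally_lipschitz ch (Oa t).
Qed.

Lemma self_coherent_reflect (R : realType) (m : nat) (Omega : set 'rV[R]_m)
    (h : 'rV[R]_m -> 'M[R]_m) (a : 'rV[R]_m) (f : R -> R) :
  self_coherent Omega h a f -> self_coherent Omega h (- a) (fun t => - f (- t)).
Proof.
move=> [a0 Oa eqf]; split; first by rewrite oppr_eq0.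
  by move=> t; rewrite scalerN -scaleNr.
move=> t i; rewrite scalerN -scaleNr mxE mulrNN -eqf.
by apply: eq_bigr => j _; apply: eq_bigr => k _; rewrite !mxE; ring.
Qed.

Lemma smooth_on_cst (R : realType) (n : nat) (D : set 'rV[R]_n) (c : R) :
  smooth_on D (fun=> c).
Proof.
move=> k; elim: k c => [|k IH] c /=; first by split=> // x _; exact: cst_continuous.
split=> [x _|j]; first exact: cst_continuous.
split; first by move=> x _; exact: derivable_cst.
have -> : partial j (fun=> c) = (fun=> 0 : R).
  by apply/funext => x; rewrite /partial derive_cst.
exact: IH.
Qed.

Lemma smooth1_derive (R : realType) (b : R -> R) : smooth1 b ->
  (forall t : R, is_derive t 1 b ((b^`())%classic t)) /\ continuous (b^`())%classic.
Proof.
move=> sb; split=> t.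
  by rewrite derive1E; apply: derivableP; exact: (sb 0%N t).
apply: differentiable_continuous; apply/derivable1_diffP; exact: (sb 1%N t).
Qed.

(** The right-hand side of the equation for the difference of two solutions
    is at most linear in the jet of the difference: with [G], [GV] the
    Christoffel symbols at the two solutions and [ct], [at_] their time
    derivatives, each product is telescoped so that every summand carries a
    factor that is small with [q].  The gradient terms are already quadratic
    in the jet, because the second solution is constant in space. *)
Lemma difference_residual_bound (R : realType) (n m : nat) (D q p beta : R)
    (i : 'I_m) (G GV : 'I_m -> 'I_m -> R) (ct at_ : 'I_m -> R)
    (wx : 'I_m -> 'I_n -> R) :
  `|p| <= D -> `|beta| <= D ->
  (forall j k, `|G j k| <= D) -> (forall j k, `|GV j k| <= D) ->
  (forall j k, `|G j k - GV j k| <= D * q) ->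
  (forall j, `|ct j| <= D) -> (forall j, `|at_ j| <= D) ->
  (forall j l, `|wx j l| <= D) ->
  (forall j, `|ct j - at_ j| <= q) -> (forall j l, `|wx j l| <= q) ->
  `|p * (ct i - at_ i)
    - \sum_j \sum_k G j k * (ct j * ct k - beta * \sum_l wx j l * wx k l)
    + \sum_j \sum_k GV j k * (at_ j * at_ k)| <=
  (D + (m * m)%:R * (D ^+ 3 + 2 * D ^+ 2 + n%:R * D ^+ 3)) * q.
Proof.
move=> pD bD GD GVD GL ctD atD wxD wtq wxq.
have q0 : 0 <= q by rewrite (le_trans _ (wtq i)).
have D0 : 0 <= D by rewrite (le_trans _ pD).
have -> : p * (ct i - at_ i)
    - \sum_j \sum_k G j k * (ct j * ct k - beta * \sum_l wx j l * wx k l)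
    + \sum_j \sum_k GV j k * (at_ j * at_ k) =
  p * (ct i - at_ i) + \sum_j \sum_k
    (- ((G j k - GV j k) * (ct j * ct k)
     + GV j k * ((ct j - at_ j) * ct k + at_ j * (ct k - at_ k)))
     + G j k * (beta * \sum_l wx j l * wx k l)).
  rewrite -addrA; congr (_ + _); rewrite addrC -sumrB; apply: eq_bigr => j _.
  by rewrite -sumrB; apply: eq_bigr => k _; ring.
rewrite (le_trans (ler_normD _ _))// mulrDl; apply: lerD.
  by rewrite normrM ler_pM.
rewrite (le_trans (ler_norm_sum _ _ _))//.
have -> : (m * m)%:R * (D ^+ 3 + 2 * D ^+ 2 + n%:R * D ^+ 3) * q =
   \sum_(j < m) \sum_(k < m) ((D ^+ 3 + 2 * D ^+ 2 + n%:R * D ^+ 3) * q).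
  rewrite !sumr_const !card_ord -!mulrnA mulr_natl -mulrnAl; congr (_ * _).
apply: ler_sum => j _; rewrite (le_trans (ler_norm_sum _ _ _))//.
apply: ler_sum => k _.
have h1 : `|(G j k - GV j k) * (ct j * ct k)| <= D * q * (D * D).
  by rewrite !normrM; do 2 (apply: ler_pM => //).
have h2 : `|(ct j - at_ j) * ct k + at_ j * (ct k - at_ k)| <= q * D + D * q.
  by rewrite (le_trans (ler_normD _ _))// !normrM lerD// ler_pM.
have h3 : `|GV j k * ((ct j - at_ j) * ct k + at_ j * (ct k - at_ k))| <= D * (q * D + D * q).
  by rewrite normrM ler_pM.
have h4 : `|\sum_l wx j l * wx k l| <= n%:R * (q * D).
  rewrite (le_trans (ler_norm_sum _ _ _))//.
  have -> : n%:R * (q * D) = \sum_(l < n) q * D by rewrite sumr_const card_ord mulr_natl.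
  by apply: ler_sum => l _; rewrite normrM ler_pM.
have h5 : `|G j k * (beta * \sum_l wx j l * wx k l)| <= D * (D * (n%:R * (q * D))).
  by rewrite !normrM; do 2 (apply: ler_pM => //).
rewrite (le_trans (ler_normD _ _))// normrN.
have := ler_normD ((G j k - GV j k) * (ct j * ct k))
  (GV j k * ((ct j - at_ j) * ct k + at_ j * (ct k - at_ k))).
lra.
Qed.

Lemma clamp_near (R : realType) (T t : R) : 0 < t < T ->
  \forall s \near t, Num.max 0 s = s /\ Num.max 0 (Num.min T s) = s.
Proof.
move=> /andP[t0 tT]; near=> s.
have s0 : 0 < s by near: s; exact: lt_nbhsr.
have sT : s < T by near: s; exact: lt_nbhsl.
by rewrite (min_r (ltW sT)) max_r ?ltW.
Unshelve. all: by end_near. Qed.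

(** The energy estimate is applied to w = u - phi(t) a.  The time argument of
    [u] is truncated below by [pl] and that of [phi] is clamped to [0, T] by
    [kp], so that the functions involved are continuous on the whole space
    while nothing changes for 0 < t < T. *)
Theorem homogeneous_solution_unique (R : realType) (n m : nat) (b : R -> R)
    (Omega : set 'rV[R]_m) (h : 'rV[R]_m -> 'M[R]_m) (a : 'rV[R]_m) (f : R -> R)
    (u : R -> 'rV[R]_n -> 'rV[R]_m) (phi psi : R -> R) (T : R) :
  smooth1 b -> (forall t, 0 < b t) ->
  riemannian_chart Omega h -> self_coherent Omega h a f -> 0 < T ->
  phi 0 = 0 ->
  (forall t : R, 0 <= t <= T -> is_derive t 1 phi (psi t)) ->
  (forall t : R, 0 <= t <= T -> is_derive t 1 psi
     (n%:R * ((b^`())%classic t / b t) * psi t - f (phi t) * psi t ^+ 2)) ->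
  global_solution b Omega h (fun=> 0) (fun=> psi 0 *: a) u ->
  forall i, u T 0 0 i = a 0 i * phi T.
Proof.
move=> sb b0 ch sc T0 phi0 Dphi Dpsi [C2 Ou eqn init0 init1] i.
have [Db cdb] := smooth1_derive sb.
set db := (b^`())%classic in Db cdb Dpsi.
have cb : continuous b by move=> t; exact: is_derive_continuous (Db t).
have [a0 Oa eqf] := sc.
pose c := component u.
pose pl (t : R) := Num.max 0 t.
pose kp (t : R) := Num.max 0 (Num.min T t).
have kpT t : 0 <= kp t <= T.
  by rewrite le_max lexx/= ge_max (ltW T0)/= ge_min lexx.
have ckp : continuous kp.
  move=> t; apply: (@continuous_max _ _ (fun=> 0) (fun t => Num.min T t)); first exact: cvg_cst.
  by apply: (@continuous_min _ _ (fun=> T) (fun t => t)); [exact: cvg_cst|exact: cvg_id].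
have cphi : continuous (phi \o kp).
  move=> t; apply: continuous_comp; first exact: ckp.
  exact: is_derive_continuous (Dphi _ (kpT t)).
have cpsi : continuous (psi \o kp).
  move=> t; apply: continuous_comp; first exact: ckp.
  exact: is_derive_continuous (Dpsi _ (kpT t)).
have jc j : jointly_continuous (fun t x => c j (pl t) x).
  by apply: within_jointly_continuous; case: (C2 j).
have jct j : jointly_continuous (fun t x => dt (c j) (pl t) x).
  by apply: within_jointly_continuous; case: (C2 j) => _ [[_ []]].
have jcx j l : jointly_continuous (fun t x => dx l (c j) (pl t) x).
  by apply: within_jointly_continuous; case: (C2 j) => _ [_ /(_ l)[_ []]].
have jcxt j l : jointly_continuous (fun t x => dx l (dt (c j)) (pl t) x).
  by apply: within_jointly_continuous; case: (C2 j) => _ [[_ [_ [_ /(_ l)[_ []]]]]].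
have jcxx j l : jointly_continuous (fun t x => dx l (dx l (c j)) (pl t) x).
  by apply: within_jointly_continuous; case: (C2 j) => _ [_ /(_ l)[_ [_ [_ /(_ l)[_ []]]]]].
have ct_ex j t x : 0 <= t -> dt_exists (c j) t x by case: (C2 j) => _ [[+ _] _]; apply.
have ctt_ex j t x : 0 <= t -> dt_exists (dt (c j)) t x.
  by case: (C2 j) => _ [[_ [_ [[+ _] _]]] _]; apply.
have cxt_ex j l t x : 0 <= t -> dt_exists (dx l (c j)) t x.
  by case: (C2 j) => _ [_ /(_ l)[_ [_ [[+ _] _]]]]; apply.
have ctx_ex j l t x : 0 <= t -> derivable (dt (c j) t) x (delta_mx 0 l).
  by case: (C2 j) => _ [[_ [_ [_ /(_ l)[+ _]]]] _]; apply.
have cxx_ex j l t x : 0 <= t -> derivable (dx l (c j) t) x (delta_mx 0 l).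
  by case: (C2 j) => _ [_ /(_ l)[_ [_ [_ /(_ l)[+ _]]]]]; apply.
pose w j t x := c j (pl t) x - a 0 j * phi (kp t).
pose wt j t x := dt (c j) (pl t) x - a 0 j * psi (kp t).
pose wx j l t x := dx l (c j) (pl t) x.
pose wxt j l t x := dx l (dt (c j)) (pl t) x.
pose wxx j l t x := dx l (dx l (c j)) (pl t) x.
pose dpsi t := n%:R * (db t / b t) * psi t - f (phi t) * psi t ^+ 2.
pose wtt j t x := dt (dt (c j)) t x - a 0 j * dpsi t.
pose beta t := b t ^+ 2.
pose dbeta t := 2 * b t * db t.
have plE t : 0 <= t -> pl t = t by move=> t0; rewrite /pl max_r.
have kpE t : 0 <= t <= T -> kp t = t.
  by move=> /andP[t0 tT]; rewrite /kp min_r// max_r.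
have bounds (g : R -> R) : continuous g ->
    \forall C \near +oo, forall t, 0 <= t <= T -> `|g t| <= C.
  move=> cg; have := compact_bounded_infty (@segment_compact R 0 T) cg.
  apply: filterS => C H t tT; apply: H; by rewrite /= in_itv.
have cbeta : continuous beta by move=> t; apply: cvgM; exact: cb.
have cdbeta : continuous dbeta.
  move=> t; apply: cvgM; last exact: cdb.
  by apply: cvgM; [exact: cvg_cst|exact: cb].
have Dbeta t : 0 < t < T -> is_derive t 1 beta (dbeta t) by move=> _; exact: is_derive_sqr.
have beta_inv : continuous (fun t => (beta t)^-1).
  by move=> t; apply: cvgV; [rewrite gt_eqF// exprn_gt0|exact: cbeta].
near (pinfty_nbhs R) => B1.
have B10 : 0 < B1 by near: B1; apply: nbhs_pinfty_gt; rewrite num_real.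
have betaB t : 0 <= t <= T -> `|beta t| <= B1.
  by move: t; near: B1; exact: bounds.
have dbetaB t : 0 <= t <= T -> `|dbeta t| <= B1.
  by move: t; near: B1; exact: bounds.
have betaVB t : 0 <= t <= T -> `|(beta t)^-1| <= B1.
  by move: t; near: B1; exact: bounds.
have bb t : 0 <= t <= T -> B1^-1 <= beta t <= B1.
  move=> tT; have be0 : 0 < beta t by exact: exprn_gt0.
  rewrite (le_trans (ler_norm _) (betaB _ tT)) andbT -[leRHS]invrK lef_pV2 ?posrE ?invr_gt0//.
  exact: le_trans (ler_norm _) (betaVB _ tT).
have res r : 0 < r -> exists2 C, 0 <= C & forall t (x : 'rV[R]_n), 0 < t < T ->
     (forall l, `|x 0 l| <= r) ->
     forall q, (forall j, [/\ `|w j t x| <= q, `|wt j t x| <= q &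
                              forall l, `|wx j l t x| <= q]) ->
     forall i, `|wtt i t x - beta t * \sum_l wxx i l t x| <= C * q.
  move=> r0; pose Q := [set p : R * 'rV[R]_n | 0 <= p.1 <= T /\ forall l, `|p.2 0 l| <= r].
  have cQ : compact Q by exact: compact_cylinder.
  have jbound (g : R -> 'rV[R]_n -> R) : jointly_continuous g ->
      \forall D \near +oo, forall p, Q p -> `|g p.1 p.2| <= D.
    by move=> cg; exact: (compact_bounded_infty cQ cg).
  pose U (p : R * 'rV[R]_n) := u (pl p.1) p.2.
  pose V (p : R * 'rV[R]_n) := phi (kp p.1) *: a.
  have cU : continuous U by apply: continuous_row => j; exact: (jc j).
  have cV : continuous V.
    move=> p; apply: cvgZ; last exact: cvg_cst.
    exact: (@jointly_continuous_time R n _ cphi).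
  have OU p : Omega (U p) by apply: Ou; rewrite le_max lexx.
  have OV p : Omega (V p) by exact: Oa.
  have lip (j : 'I_m * 'I_m * 'I_m) v : Omega v ->
      locally_lipschitz (christoffel h j.1.1 j.1.2 j.2) v.
    exact: christoffel_locally_lipschitz ch.
  have gcont (W : R * 'rV[R]_n -> 'rV[R]_m) (j : 'I_m * 'I_m * 'I_m) :
      continuous W -> (forall p, Omega (W p)) ->
      \forall D \near +oo, forall p, Q p -> `|christoffel h j.1.1 j.1.2 j.2 (W p)| <= D.
    move=> cW OW; apply: (compact_bounded_infty cQ) => p.
    apply: (@continuous_comp _ _ _ W (christoffel h j.1.1 j.1.2 j.2)); first exact: cW.
    exact/locally_lipschitz_continuous/lip.
  (* Finitely many bounds, each valid for all large constants, are collected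
     below to hold with one constant D. *)
  pose PG (W : R * 'rV[R]_n -> 'rV[R]_m) (j : 'I_m * 'I_m * 'I_m) (D : R) :=
    forall p, Q p -> `|christoffel h j.1.1 j.1.2 j.2 (W p)| <= D.
  pose PL (j : 'I_m * 'I_m * 'I_m) (D : R) := forall p, Q p ->
      `|christoffel h j.1.1 j.1.2 j.2 (U p) - christoffel h j.1.1 j.1.2 j.2 (V p)|
        <= D * `|U p - V p|.
  pose Pct (j : 'I_m) (D : R) := forall p, Q p -> `|dt (c j) (pl p.1) p.2| <= D.
  pose Pat (j : 'I_m) (D : R) := forall t, 0 <= t <= T -> `|a 0 j * psi (kp t)| <= D.
  pose Pwx (j : 'I_m * 'I_n) (D : R) := forall p, Q p ->
    `|dx j.2 (c j.1) (pl p.1) p.2| <= D.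
  have hG : \forall D \near +oo, forall j, PG U j D.
    have H j : \forall D \near +oo, PG U j D by exact: gcont.
    exact: filter_forall H.
  have hGV : \forall D \near +oo, forall j, PG V j D.
    have H j : \forall D \near +oo, PG V j D by exact: gcont.
    exact: filter_forall H.
  have hL : \forall D \near +oo, forall j, PL j D.
    have H j : \forall D \near +oo, PL j D.
      exact: (compact_lipschitz_infty cQ cU cV
        (fun p => lip j (U p) (OU p)) (fun p => lip j (V p) (OV p))).
    exact: filter_forall H.
  have hct : \forall D \near +oo, forall j, Pct j D.
    have H j : \forall D \near +oo, Pct j D by exact: jbound (jct j).
    exact: filter_forall H.
  have hat : \forall D \near +oo, forall j, Pat j D.
    have H j : \forall D \near +oo, Pat j D.
      by apply: (bounds) => t; apply: cvgM; [exact: cvg_cst|exact: cpsi].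
    exact: filter_forall H.
  have hwx : \forall D \near +oo, forall j, Pwx j D.
    have H j : \forall D \near +oo, Pwx j D by exact: jbound (jcx j.1 j.2).
    exact: filter_forall H.
  have hp : \forall D \near +oo, forall t, 0 <= t <= T ->
      `|n%:R * (db t / b t)| <= D.
    apply: (bounds) => t; apply: cvgM; first exact: cvg_cst.
    by apply: cvgM; [exact: cdb|apply: cvgV; [rewrite gt_eqF|exact: cb]].
  have hb := bounds _ cbeta.
  near (pinfty_nbhs R) => D.
  have GD : forall j, PG U j D by near: D; exact: hG.
  have GVD : forall j, PG V j D by near: D; exact: hGV.
  have LD : forall j, PL j D by near: D; exact: hL.
  have ctD : forall j, Pct j D by near: D; exact: hct.
  have atD : forall j, Pat j D by near: D; exact: hat.
  have wxD : forall j, Pwx j D by near: D; exact: hwx.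
  have pD : forall t, 0 <= t <= T -> `|n%:R * (db t / b t)| <= D by near: D; exact: hp.
  have bD : forall t, 0 <= t <= T -> `|beta t| <= D by near: D; exact: hb.
  have D0 : 0 <= D by near: D; apply: nbhs_pinfty_ge; rewrite num_real.
  exists (D + (m * m)%:R * (D ^+ 3 + 2 * D ^+ 2 + n%:R * D ^+ 3)).
    by rewrite addr_ge0// mulr_ge0// !addr_ge0 ?mulr_ge0 ?exprn_ge0.
  move=> t x tT xr q Hq k.
  have tT' : 0 <= t <= T by case/andP: tT => /ltW -> /ltW ->.
  have t0 : 0 <= t by case/andP: tT'.
  have Qtx : Q (t, x) by split.
  have HG j1 j2 : `|christoffel h k j1 j2 (u t x)| <= D.
    have := GD (k, j1, j2) (t, x) Qtx; rewrite /U/= plE//.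
  have HGV j1 j2 : `|christoffel h k j1 j2 (phi t *: a)| <= D.
    have := GVD (k, j1, j2) (t, x) Qtx; rewrite /V/= kpE//.
  have Hct j : `|dt (c j) t x| <= D.
    have := ctD j (t, x) Qtx; rewrite /= plE//.
  have Hat j : `|a 0 j * psi t| <= D.
    have := atD j t tT'; rewrite kpE//.
  have Hwx j l : `|dx l (c j) t x| <= D.
    have := wxD (j, l) (t, x) Qtx; rewrite /= plE//.
  have Hp : `|n%:R * (db t / b t)| <= D by exact: pD.
  have Hb : `|beta t| <= D by exact: bD.
  have q0 : 0 <= q by have [wq _ _] := Hq k; exact: le_trans wq.
  have UV : `|u t x - phi t *: a| <= q.
    apply: norm_le_coord => // j; have [+ _ _] := Hq j.
    by rewrite /w plE// kpE// !mxE [_ * a 0 j]mulrC.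
  have HL j1 j2 : `|christoffel h k j1 j2 (u t x)
                    - christoffel h k j1 j2 (phi t *: a)| <= D * q.
    apply: le_trans (ler_wpM2l D0 UV).
    have := LD (k, j1, j2) (t, x) Qtx; rewrite /U/V/= plE// kpE//.
  have Hwt j : `|dt (c j) t x - a 0 j * psi t| <= q.
    by have [_ + _] := Hq j; rewrite /wt plE// kpE.
  have Hwxq j l : `|dx l (c j) t x| <= q.
    by have [_ _ /(_ l)] := Hq j; rewrite /wx plE.
  pose L := \sum_l dx l (dx l (c k)) t x.
  pose S := \sum_j1 \sum_j2 christoffel h k j1 j2 (u t x) *
    (dt (c j1) t x * dt (c j2) t x
     - beta t * \sum_l dx l (c j1) t x * dx l (c j2) t x).
  pose SV := \sum_j1 \sum_j2 christoffel h k j1 j2 (phi t *: a) *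
    (a 0 j1 * psi t * (a 0 j2 * psi t)).
  have SVE : SV = a 0 k * f (phi t) * psi t ^+ 2.
    rewrite -eqf mulr_suml; apply: eq_bigr => j1 _; rewrite mulr_suml.
    by apply: eq_bigr => j2 _; ring.
  have E : dt (dt (c k)) t x - n%:R * (db t / b t) * dt (c k) t x
      - beta t * L + S = 0 by exact: eqn k t x t0.
  have LE : \sum_l wxx k l t x = L by apply: eq_bigr => l _; rewrite /wxx plE.
  have -> : wtt k t x - beta t * \sum_l wxx k l t x =
     n%:R * (db t / b t) * (dt (c k) t x - a 0 k * psi t) - S + SV.
    rewrite LE SVE /wtt /dpsi.
    move: (beta t * L) S E => X Y; clear; lra.
  exact: (@difference_residual_bound R n m D q (n%:R * (db t / b t)) (beta t) k
    (fun j1 j2 => christoffel h k j1 j2 (u t x))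
    (fun j1 j2 => christoffel h k j1 j2 (phi t *: a))
    (fun j => dt (c j) t x) (fun j => a 0 j * psi t) (fun j l => dx l (c j) t x)
    Hp Hb HG HGV HL Hct Hat Hwx Hwt Hwxq).
have init j x : [/\ w j 0 x = 0, wt j 0 x = 0 & forall l, wx j l 0 x = 0].
  have k0 : kp 0 = 0 by rewrite kpE// lexx ltW.
  rewrite /w /wt /wx plE// k0 phi0 mulr0 subr0; split.
  - by rewrite /c /component init0 mxE.
  - by rewrite init1 mxE mulrC subrr.
  - move=> l; rewrite /dx /partial.
    have -> : c j 0 = (fun=> 0) by apply/funext => y; rewrite /c /component init0 mxE.
    by rewrite derive_cst.
suff : w i T 0 = 0.
  rewrite /w plE ?ltW// kpE ?lexx ?ltW// /c /component => /eqP.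
  by rewrite subr_eq0 => /eqP.
have B1V0 : 0 < B1^-1 by rewrite invr_gt0.
have cw j : jointly_continuous (w j).
  apply: jointly_continuousD; first exact: jc.
  by apply: jointly_continuous_time => t; apply: cvgN; apply: cvgM; [exact: cvg_cst|exact: cphi].
have cwt j : jointly_continuous (wt j).
  apply: jointly_continuousD; first exact: jct.
  by apply: jointly_continuous_time => t; apply: cvgN; apply: cvgM; [exact: cvg_cst|exact: cpsi].
have Dw j t x : 0 < t < T -> is_derive t 1 (w j ^~ x) (wt j t x).
  move=> tT; have tT' : 0 <= t <= T by case/andP: tT => /ltW -> /ltW ->.
  have t0 : 0 < t by case/andP: tT.
  rewrite /wt plE ?ltW// kpE//.
  have D := is_deriveB (is_derive_dt t0 (ct_ex j t x (ltW t0)))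
    (is_derive_mul (is_derive_cst (a 0 j) t 1) (Dphi t tT')).
  rewrite mul0r add0r in D; apply: near_eq_is_derive D.
  by apply: filterS (clamp_near tT) => s [e1 e2]; rewrite /w /pl /kp e1 e2.
have Dwt j t x : 0 < t < T -> is_derive t 1 (wt j ^~ x) (wtt j t x).
  move=> tT; have tT' : 0 <= t <= T by case/andP: tT => /ltW -> /ltW ->.
  have t0 : 0 < t by case/andP: tT.
  have D := is_deriveB (is_derive_dt t0 (ctt_ex j t x (ltW t0)))
    (is_derive_mul (is_derive_cst (a 0 j) t 1) (Dpsi t tT')).
  rewrite mul0r add0r in D; apply: near_eq_is_derive D.
  by apply: filterS (clamp_near tT) => s [e1 e2]; rewrite /wt /pl /kp e1 e2.
have Dwx j l t x : 0 < t < T -> is_derive t 1 (wx j l ^~ x) (wxt j l t x).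
  move=> tT; have t0 : 0 < t by case/andP: tT.
  have -> : wxt j l t x = dt (dx l (c j)) t x.
    by rewrite /wxt (plE t (ltW t0)) (mixed_derivatives_agree l x (C2 j) t0).
  have D := is_derive_dt t0 (cxt_ex j l t x (ltW t0)); apply: near_eq_is_derive D.
  by apply: filterS (clamp_near tT) => s [e1 e2]; rewrite /wx /pl e1.
have Dxwt j l t x : 0 < t < T ->
    is_derive x (delta_mx 0 l) (wt j t) (wxt j l t x).
  move=> tT; have t0 : 0 < t by case/andP: tT.
  have -> : wt j t = (fun y => dt (c j) t y - a 0 j * psi (kp t)).
    by apply/funext => y; rewrite /wt plE ?ltW.
  rewrite /wxt plE ?ltW//.
  have D := is_deriveB (is_derive_dx (ctx_ex j l t x (ltW t0)))
    (is_derive_cst (a 0 j * psi (kp t)) x (delta_mx 0 l)).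
  by rewrite subr0 in D.
have Dxwx j l t x : 0 < t < T ->
    is_derive x (delta_mx 0 l) (wx j l t) (wxx j l t x).
  move=> tT; have t0 : 0 < t by case/andP: tT.
  by rewrite /wxx /wx plE ?ltW//; exact: is_derive_dx (cxx_ex j l t x (ltW t0)).
exact: (@energy_uniqueness R n m T beta dbeta w wt wtt wx wxt wxx B1^-1 B1 T0
  cbeta Dbeta B1V0 bb dbetaB cw cwt jcx jcxt jcxx Dw Dwt Dwx Dxwt Dxwx res init i).
Unshelve. all: by end_near. Qed.

(** * Divergence of the integrals *)

(** The global solution with the data of the profile coincides with it on
    [0, 1) at x = 0, hence is unbounded there, although it is continuous at
    t = 1. *)
Lemma forward_divergence (R : realType) (n m : nat) (b : R -> R)
    (Omega : set 'rV[R]_m) (h : 'rV[R]_m -> 'M[R]_m) (a : 'rV[R]_m) (f : R -> R) :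
  smooth1 b -> (forall t, 0 < b t) ->
  riemannian_chart Omega h -> self_coherent Omega h a f ->
  globally_solvable n b Omega h ->
  (\int[lebesgue_measure]_(s in `[0%R, +oo[) (expR (int0 f s))%:E = +oo)%E.
Proof.
move=> sb b0 ch sc solv; apply/eqP; apply: contrapT => /negP fin.
have cf := self_coherent_continuous ch sc.
have [Db _] := smooth1_derive sb.
have [phi [psi [phi0 Dphi Dpsi blowup]]] := @blowup_profile R n _ _ _ cf Db b0 fin.
have [a0 Oa _] := sc.
have [i ai] := exists_nonzero_coord a0.
have [u su] : exists u : R -> 'rV[R]_n -> 'rV[R]_m,
    global_solution b Omega h (fun=> 0) (fun=> psi 0 *: a) u.
  apply: (solv (fun=> 0) (fun=> psi 0 *: a)).
  - by move=> j; exact: smooth_on_cst.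
  - by move=> j; exact: smooth_on_cst.
  - by move=> x; rewrite -(scale0r a); exact: Oa.
have uE T : 0 < T -> T < 1 -> u T 0 0 i = a 0 i * phi T.
  move=> T0 T1.
  have lt1 t : 0 <= t <= T -> 0 <= t < 1.
    by move=> /andP[-> tT]; exact: le_lt_trans tT T1.
  exact: (homogeneous_solution_unique sb b0 ch sc T0 phi0
    (fun t tT => Dphi t (lt1 t tT)) (fun t tT => Dpsi t (lt1 t tT)) su i).
have ju : jointly_continuous (fun t x => component u i (Num.max 0 t) x).
  by apply: within_jointly_continuous; case: (sol_C2 su i).
have cu : continuous (fun t : R => component u i (Num.max 0 t) 0).
  exact: jointly_continuous_slice ju.
have nb := near_bounded (cu 1).
set K := _ + 1 in nb.
have large : \forall t \near (1 : R)^'-, K / `|a 0 i| < phi t by exact: blowup.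
have bounded : \forall t \near (1 : R)^'-, `|component u i (Num.max 0 t) 0| <= K.
  exact: cvg_within nb.
have absurd : \forall t \near (1 : R)^'-, False.
  near=> t.
  have t1 : t < 1 by near: t; exact: nbhs_left_lt.
  have t0 : 0 < t by near: t; exact: nbhs_left_gt.
  have uK : `|component u i (Num.max 0 t) 0| <= K by near: t; exact: bounded.
  have phiK : K / `|a 0 i| < phi t by near: t; exact: large.
  rewrite /component (max_r (ltW t0)) (uE t t0 t1) normrM in uK.
  rewrite ltr_pdivrMr ?normr_gt0// mulrC in phiK.
  have := lt_le_trans phiK (ler_wpM2l (normr_ge0 (a 0 i)) (ler_norm (phi t))).
  by rewrite ltNge uK.
by have [] := @filter_ex _ _ _ _ absurd.
Unshelve. all: by end_near. Qed.

Theorem theorem2 (R : realType) (n m : nat) (b : R -> R)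
    (Omega : set 'rV[R]_m) (h : 'rV[R]_m -> 'M[R]_m)
    (a : 'rV[R]_m) (f : R -> R) :
  (1 <= n)%N -> (1 <= m)%N ->
  smooth1 b -> (forall t, 0 < b t) -> (exists2 T, 0 < T & periodic b T) ->
  riemannian_chart Omega h ->
  self_coherent Omega h a f ->
  globally_solvable n b Omega h ->
  (\int[lebesgue_measure]_(s in `[0%R, +oo[) (expR (int0 f s))%:E = +oo)%E /\
  (\int[lebesgue_measure]_(s in `]-oo, 0%R]) (expR (int0 f s))%:E = +oo)%E.
Proof.
move=> _ _ sb b0 _ ch sc solv; split; first exact: forward_divergence ch sc solv.
have cf := self_coherent_continuous ch sc.
have := forward_divergence sb b0 ch (self_coherent_reflect sc) solv.
have -> : (fun s => (expR (int0 (fun t => - f (- t)) s))%:E) =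
    (fun s => (((expR \o int0 f) \o -%R) s)%:E).
  by apply/funext => s; rewrite int0_reflect.
rewrite -ge0_integration_by_substitutionNy ?oppr0//.
- apply: continuous_subspaceT => s; apply: continuous_comp; first exact: int0_continuous.
  exact: continuous_expR.
- by move=> s _; exact: expR_ge0.
Qed.
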